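(* Let $\psi$ be analytic and univalent in $\Delta$ with $\psi(0)=0$ and $\psi(\Delta)$ starlike with respect to $0$. Suppose that for every $r\in(0,1)$ $$\max_{|z|=r}\Re\psi(z)=\psi(r)\quad\text{and}\quad \min_{|z|=r}\Re\psi(z)=\psi(-r).$$ Then every $f\in\mathcal{F}(\psi)$ satisfies, for $|z|=r$, $0<r<1$, $$r\exp\left(\int_0^r\frac{\psi(-t)}{t}\,dt\right)\le |f(z)|\le r\exp\left(\int_0^r\frac{\psi(t)}{t}\,dt\right),$$ and these inequalities are sharp (for each $r$, each bound is attained by some $f\in\mathcal{F}(\psi)$ at some point with $|z|=r$).
   Context: $\Delta=\{z\in\mathbb{C}:|z|<1\}$. $\mathcal{A}$ is the class of analytic functions $f(z)=z+\sum_{k\ge2}a_kz^k$ in $\Delta$. For analytic $g,h$ on $\Delta$, $g\prec h$ (subordination) means $g=h\circ\omega$ for some analytic $\omega:\Delta\to\Delta$ with $\omega(0)=0$. $\mathcal{F}(\psi)$ is the class of $f\in\mathcal{A}$ with $\frac{zf'(z)}{f(z)}-1\prec\psi(z)$ in $\Delta$ (in particular $zf'(z)/f(z)$ is analytic in $\Delta$). Functions in $\mathcal{F}(\psi)$ need not be univalent. *)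

(* Defs.v *)
From Stdlib Require Export Reals.
From Coquelicot Require Export Coquelicot.

Open Scope R_scope.

Definition unit_disc (z : C) : Prop := Cmod z < 1.

(* Functions on the disc are represented by total functions C -> C. The disc is
   open, so complex differentiability at its points does not depend on the
   values taken outside it. *)
Definition analytic_on_disc (f : C -> C) : Prop :=
  forall z : C, unit_disc z -> ex_derive (K := C_AbsRing) (V := C_NormedModule) f z.

Definition univalent_on_disc (f : C -> C) : Prop :=
  forall z w : C, unit_disc z -> unit_disc w -> f z = f w -> z = w.

Definition disc_image (f : C -> C) (w : C) : Prop :=
  exists z : C, unit_disc z /\ f z = w.

Definition starlike_wrt_0 (D : C -> Prop) : Prop :=
  forall (w : C) (t : R), D w -> 0 <= t <= 1 -> D (RtoC t * w)%C.

Definition class_A (f : C -> C) : Prop :=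
  analytic_on_disc f /\
  exists a : nat -> C, forall z : C, unit_disc z ->
    exists s : C,
      is_series (K := C_AbsRing) (V := C_NormedModule)
        (fun k : nat => (a (k + 2)%nat * z ^ (k + 2))%C) s /\
      f z = (z + s)%C.

Definition subordinate (g h : C -> C) : Prop :=
  analytic_on_disc g /\ analytic_on_disc h /\
  exists omega : C -> C,
    analytic_on_disc omega /\
    (forall z : C, unit_disc z -> unit_disc (omega z)) /\
    omega (RtoC 0) = RtoC 0 /\
    forall z : C, unit_disc z -> g z = h (omega z).

(* z f'(z) / f(z), with the removable singularity at the origin filled in:
   for f in class A the quotient tends to 1 there. *)
Definition zf'_over_f (f : C -> C) (z : C) : C :=
  if Ceq_dec z (RtoC 0) then RtoC 1 else (z * C_derive f z / f z)%C.

(* Since division by zero is total, the requirement that z f' / f have no pole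
   in the disc is the explicit condition that f vanish only at the origin. *)
Definition class_F (psi f : C -> C) : Prop :=
  class_A f /\
  (forall z : C, unit_disc z -> z <> RtoC 0 -> f z <> RtoC 0) /\
  subordinate (fun z : C => (zf'_over_f f z - RtoC 1)%C) psi.

Definition is_maximum (E : R -> Prop) (m : R) : Prop :=
  E m /\ forall x : R, E x -> x <= m.

Definition is_minimum (E : R -> Prop) (m : R) : Prop :=
  E m /\ forall x : R, E x -> m <= x.

Definition Re_values_on_circle (f : C -> C) (r x : R) : Prop :=
  exists z : C, Cmod z = r /\ x = Re (f z).

(* Equality of a complex value with a real maximum (or minimum) includes that
   this value is real. *)
Definition circle_max_Re (f : C -> C) (r : R) (v : C) : Prop :=
  exists m : R, is_maximum (Re_values_on_circle f r) m /\ RtoC m = v.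

Definition circle_min_Re (f : C -> C) (r : R) (v : C) : Prop :=
  exists m : R, is_minimum (Re_values_on_circle f r) m /\ RtoC m = v.

(* The values psi(t) and psi(-t) are real where these are used. The integrand
   at t = 0 is immaterial to the Riemann integral. *)
Definition growth_upper (psi : C -> C) (r : R) : R :=
  r * exp (RInt (fun t : R => Re (psi (RtoC t)) / t) 0 r).

Definition growth_lower (psi : C -> C) (r : R) : R :=
  r * exp (RInt (fun t : R => Re (psi (RtoC (- t))) / t) 0 r).

(* Main.v *)
Require Import Defs.
From Stdlib Require Import Lra Lia Wf_nat Ranalysis5 ClassicalEpsilon Classical.

(** On a ray from 0, the derivative of ln |f (t z) / t| in [t] is
    Re (z f' / f - 1) / t evaluated at [t z], which the subordination turns into
    Re psi (om (t z)) / t with [om] a self-map of the disc fixing 0. Schwarz's lemma puts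
    [om (t z)] into the disc of radius [t |z|]. On that disc [Re psi] lies between
    [psi (- t |z|)] and [psi (t |z|)]: on each circle this is the hypothesis, and the
    bounds are monotone in the radius because [psi] is real and injective on the real
    axis ([Re_bounds_in_disc]). Integrating from 0, where f z / z tends to 1, gives both
    inequalities ([growth_bounds]). With [om] the identity all the estimates are equalities
    on the real axis: the function f z = z exp (H z), where [H] is the primitive of
    psi z / z, attains the upper bound at [r] and the lower bound at [- r]
    ([extremal_class_F]).

    The function theory behind this is derived from complex differentiability alone.
    Goursat's theorem on rectangles, proved by bisection and then extended to functions
    that are merely continuous at one point ([goursat_except]), gives primitives on the disc
    ([primitive_on_disc]). Applied to the difference quotient of [f] at [w], a primitive
    makes its integral over a circle vanish, and this is Cauchy's formula
    ([cauchy_formula]). Expanding the Cauchy kernel as a finite geometric sum with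
    remainder yields Taylor's theorem with a bound ([cauchy_taylor]), from which three
    things are needed: the power series that membership in the class A asks of the extremal
    function ([class_A_of_holo]), the holomorphy of psi z / z at the origin
    ([holo_quotient]), and the maximum principle behind Schwarz's lemma
    ([max_modulus_circle]). *)

(** * Complex derivatives *)

(** Complex differentiability, with the filters of [is_derive] unfolded into epsilon and
    delta ([cderiv_iff]): most arguments below estimate the error term directly. *)
Definition cderiv (f : C -> C) (z l : C) : Prop :=
  forall eps, 0 < eps -> exists d, 0 < d /\
    forall w, Cmod (w - z)%C < d ->
      Cmod (f w - f z - l * (w - z))%C <= eps * Cmod (w - z)%C.

Definition ccont (f : C -> C) (z : C) : Prop :=
  forall eps, 0 < eps -> exists d, 0 < d /\
    forall w, Cmod (w - z)%C < d -> Cmod (f w - f z)%C < eps.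

Lemma Cmod_minus_sym (a b : C) : Cmod (a - b)%C = Cmod (b - a)%C.
Proof. rewrite <- Cmod_opp. f_equal. ring. Qed.

Lemma Cmod_triangle_minus (a b : C) : Cmod (a - b)%C <= Cmod a + Cmod b.
Proof.
  unfold Cminus. eapply Rle_trans; [apply Cmod_triangle|].
  rewrite Cmod_opp. apply Rle_refl.
Qed.

Lemma Cmod_triangle_inv (a b : C) : Cmod a - Cmod b <= Cmod (a - b)%C.
Proof.
  pose proof (Cmod_triangle (a - b) b) as H.
  replace (a - b + b)%C with a in H by ring. lra.
Qed.

Lemma Cmod_self_minus (z : C) : Cmod (z - z)%C = 0.
Proof. replace (z - z)%C with (RtoC 0) by ring. apply Cmod_0. Qed.

Lemma Im_le_Cmod (c : C) : Rabs (Im c) <= Cmod c.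
Proof.
  pose proof (Rmax_Cmod c). pose proof (Rmax_r (Rabs (fst c)) (Rabs (snd c))).
  unfold Im. lra.
Qed.

(** Reduces a bound on a complex number to one on each coordinate. *)
Lemma Cmod_le_abs (c : C) : Cmod c <= Rabs (Re c) + Rabs (Im c).
Proof.
  destruct c as [x y]. unfold Re, Im. simpl.
  replace (x, y) with (RtoC x + Ci * RtoC y)%C.
  - eapply Rle_trans; [apply Cmod_triangle|].
    rewrite Cmod_mult, Cmod_Ci, !Cmod_R. lra.
  - unfold Ci, RtoC, Cplus, Cmult. simpl. f_equal; ring.
Qed.

Lemma cderiv_iff (f : C -> C) (z l : C) :
  is_derive (K := C_AbsRing) (V := C_NormedModule) f z l <-> cderiv f z l.
Proof.
  split.
  - intros [_ H] eps He.
    specialize (H z (fun P HP => HP) (mkposreal eps He)).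
    destruct H as [d Hd]. exists d. split; [apply cond_pos|].
    intros w Hw. specialize (Hd w Hw).
    unfold norm, minus, plus, opp, scal in Hd. simpl in Hd.
    unfold mult in Hd. simpl in Hd.
    replace (f w - f z - l * (w - z))%C with (f w + - f z + - ((w + - z) * l))%C by ring.
    exact Hd.
  - intros H. split.
    + apply is_linear_scal_l.
    + intros x Hx.
      assert (x = z) as ->.
      { symmetry. apply (is_filter_lim_locally_unique (V := AbsRing_NormedModule C_AbsRing)). exact Hx. }
      intros eps. destruct (H eps (cond_pos eps)) as [d [Hd Hd2]].
      exists (mkposreal d Hd). intros w Hw. specialize (Hd2 w Hw).
      unfold norm, minus, plus, opp, scal. simpl. unfold mult. simpl.
      replace (f w + - f z + - ((w + - z) * l))%C with (f w - f z - l * (w - z))%C by ring.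
      exact Hd2.
Qed.

Lemma ex_derive_cderiv (f : C -> C) (z : C) :
  ex_derive (K := C_AbsRing) (V := C_NormedModule) f z <-> exists l, cderiv f z l.
Proof.
  split; intros [l H]; exists l; apply cderiv_iff; exact H.
Qed.

Lemma cderiv_ccont (f : C -> C) (z l : C) : cderiv f z l -> ccont f z.
Proof.
  intros H eps He. destruct (H 1 Rlt_0_1) as [d [Hd Hd2]].
  set (k := 1 + Cmod l).
  assert (0 < k) by (unfold k; pose proof (Cmod_ge_0 l); lra).
  exists (Rmin d (eps / k)). split.
  { apply Rmin_pos; auto. apply Rdiv_lt_0_compat; lra. }
  intros w Hw.
  assert (Cmod (w - z)%C < d) as Hw1 by (eapply Rlt_le_trans; [exact Hw|apply Rmin_l]).
  assert (Cmod (w - z)%C < eps / k) as Hw2 by (eapply Rlt_le_trans; [exact Hw|apply Rmin_r]).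
  specialize (Hd2 w Hw1).
  replace (f w - f z)%C with ((f w - f z - l * (w - z)) + l * (w - z))%C by ring.
  eapply Rle_lt_trans; [apply Cmod_triangle|]. rewrite Cmod_mult.
  apply Rle_lt_trans with (k * Cmod (w - z)%C); [unfold k; lra|].
  apply Rmult_lt_compat_l with (r := k) in Hw2; auto.
  replace (k * (eps / k)) with eps in Hw2 by (field; lra). exact Hw2.
Qed.

Lemma cderiv_unique (f : C -> C) (z a b : C) : cderiv f z a -> cderiv f z b -> a = b.
Proof.
  intros Ha Hb. rewrite <- cderiv_iff in Ha, Hb.
  apply is_C_derive_unique in Ha. apply is_C_derive_unique in Hb. congruence.
Qed.

Lemma cderiv_ext_loc (f g : C -> C) (z l : C) (d : R) :
  0 < d -> (forall w, Cmod (w - z)%C < d -> f w = g w) -> cderiv f z l -> cderiv g z l.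
Proof.
  intros Hd E H eps He. destruct (H eps He) as [d2 [Hd2 H2]].
  exists (Rmin d d2). split; [apply Rmin_pos; auto|].
  intros w Hw.
  assert (Cmod (w - z)%C < d) by (eapply Rlt_le_trans; [exact Hw|apply Rmin_l]).
  assert (Cmod (w - z)%C < d2) by (eapply Rlt_le_trans; [exact Hw|apply Rmin_r]).
  rewrite <- !E; auto. rewrite Cmod_self_minus. exact Hd.
Qed.

Lemma cderiv_plus f g z a b : cderiv f z a -> cderiv g z b ->
  cderiv (fun w => (f w + g w)%C) z (a + b)%C.
Proof.
  rewrite <- !cderiv_iff. intros. apply (is_derive_plus (K := C_AbsRing) f g z a b); auto.
Qed.

Lemma cderiv_const c z : cderiv (fun _ => c) z (RtoC 0).
Proof. apply cderiv_iff. apply (is_derive_const (K := C_AbsRing) (V:=C_NormedModule)). Qed.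

Lemma cderiv_id z : cderiv (fun w => w) z (RtoC 1).
Proof.
  intros eps He. exists 1. split; [lra|]. intros w _.
  replace (w - z - 1 * (w - z))%C with (RtoC 0) by ring.
  rewrite Cmod_0. apply Rmult_le_pos; [lra|apply Cmod_ge_0].
Qed.

Lemma cderiv_affine p u l z : cderiv (fun w => u + l * (w - p))%C z l.
Proof.
  intros eps He. exists 1. split; [lra|]. intros w _.
  replace (u + l * (w - p) - (u + l * (z - p)) - l * (w - z))%C with (RtoC 0) by ring.
  rewrite Cmod_0. apply Rmult_le_pos; [lra|apply Cmod_ge_0].
Qed.

Lemma cderiv_minus_const w z : cderiv (fun x => x - w)%C z (RtoC 1).
Proof.
  apply (cderiv_ext_loc (fun x => - w + 1 * (x - 0))%C _ z _ 1); [lra|intros; ring|].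
  apply cderiv_affine.
Qed.

Lemma cderiv_comp f g z a b : cderiv f (g z) a -> cderiv g z b ->
  cderiv (fun w => f (g w)) z (a * b)%C.
Proof.
  intros Hf Hg eps He.
  set (k := 1 + Cmod b).
  assert (0 < k) by (unfold k; pose proof (Cmod_ge_0 b); lra).
  set (ka := 1 + Cmod a).
  assert (0 < ka) by (unfold ka; pose proof (Cmod_ge_0 a); lra).
  destruct (Hf (eps / 2 / k)) as [d1 [Hd1 H1]].
  { apply Rdiv_lt_0_compat; lra. }
  destruct (cderiv_ccont _ _ _ Hg d1 Hd1) as [d2 [Hd2 H2]].
  destruct (Hg 1 Rlt_0_1) as [d3 [Hd3 H3]].
  destruct (Hg (eps / 2 / ka)) as [d4 [Hd4 H4]].
  { apply Rdiv_lt_0_compat; lra. }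
  exists (Rmin d2 (Rmin d3 d4)). split; [repeat apply Rmin_pos; auto|].
  intros w Hw.
  pose proof (Rmin_l d2 (Rmin d3 d4)). pose proof (Rmin_r d2 (Rmin d3 d4)).
  pose proof (Rmin_l d3 d4). pose proof (Rmin_r d3 d4).
  specialize (H2 w ltac:(lra)). specialize (H3 w ltac:(lra)). specialize (H4 w ltac:(lra)).
  specialize (H1 (g w) H2).
  assert (Cmod (g w - g z)%C <= k * Cmod (w - z)%C) as Hk.
  { replace (g w - g z)%C with ((g w - g z - b * (w - z)) + b * (w - z))%C by ring.
    eapply Rle_trans; [apply Cmod_triangle|]. rewrite Cmod_mult. unfold k; lra. }
  replace (f (g w) - f (g z) - a * b * (w - z))%C
    with ((f (g w) - f (g z) - a * (g w - g z)) + a * (g w - g z - b * (w - z)))%C by ring.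
  eapply Rle_trans; [apply Cmod_triangle|]. rewrite Cmod_mult.
  assert (eps / 2 / k * Cmod (g w - g z)%C <= eps / 2 * Cmod (w - z)%C).
  { replace (eps / 2 * Cmod (w - z)%C) with (eps / 2 / k * (k * Cmod (w - z)%C)) by (field; lra).
    apply Rmult_le_compat_l; auto. apply Rlt_le. apply Rdiv_lt_0_compat; lra. }
  assert (Cmod a * Cmod (g w - g z - b * (w - z))%C <= eps / 2 * Cmod (w - z)%C).
  { replace (eps / 2 * Cmod (w - z)%C) with (ka * (eps / 2 / ka * Cmod (w - z)%C)) by (field; lra).
    apply Rmult_le_compat; auto using Cmod_ge_0. unfold ka; lra. }
  lra.
Qed.

Lemma cderiv_scal c f z a : cderiv f z a -> cderiv (fun w => (c * f w)%C) z (c * a)%C.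
Proof.
  intros H. apply (cderiv_comp (fun w => c * w)%C f); auto.
  intros eps He. exists 1. split; [lra|]. intros w _.
  replace (c * w - c * f z - c * (w - f z))%C with (RtoC 0) by ring.
  rewrite Cmod_0. apply Rmult_le_pos; [lra|apply Cmod_ge_0].
Qed.

Lemma cderiv_sqr z : cderiv (fun w => (w * w)%C) z (2 * z)%C.
Proof.
  intros eps He. exists eps. split; auto. intros w Hw.
  replace (w * w - z * z - 2 * z * (w - z))%C with ((w - z) * (w - z))%C by ring.
  rewrite Cmod_mult. apply Rmult_le_compat_r; [apply Cmod_ge_0|lra].
Qed.

(** By polarization, [2 f g = (f + g)^2 - f^2 - g^2], this follows from the chain
    rule for the square and from linearity. *)
Lemma cderiv_mult f g z a b : cderiv f z a -> cderiv g z b ->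
  cderiv (fun w => (f w * g w)%C) z (a * g z + f z * b)%C.
Proof.
  intros Hf Hg.
  pose proof (cderiv_comp (fun w => w * w)%C _ z _ _ (cderiv_sqr _) (cderiv_plus _ _ _ _ _ Hf Hg)) as H1.
  pose proof (cderiv_comp (fun w => w * w)%C _ z _ _ (cderiv_sqr _) Hf) as H2.
  pose proof (cderiv_comp (fun w => w * w)%C _ z _ _ (cderiv_sqr _) Hg) as H3.
  cbv beta in *.
  pose proof (cderiv_scal (/ 2)%C _ _ _
    (cderiv_plus _ _ _ _ _ H1
      (cderiv_scal (- (1))%C _ _ _ (cderiv_plus _ _ _ _ _ H2 H3)))) as H4.
  cbv beta in H4.
  replace (a * g z + f z * b)%C with (/ 2 *
         (2 * (f z + g z) * (a + b) +
          - (1) * (2 * f z * a + 2 * g z * b)))%C by now field.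
  apply (cderiv_ext_loc _ _ _ _ 1 Rlt_0_1) with (2 := H4).
  intros w _. cbv beta. now field.
Qed.

Lemma cderiv_inv z : z <> RtoC 0 -> cderiv (fun w => (/ w)%C) z (- / (z * z))%C.
Proof.
  intros Hz eps He.
  assert (0 < Cmod z) as Hm by (apply Cmod_gt_0; auto).
  set (m := Cmod z) in *.
  exists (Rmin (m / 2) (eps * m ^ 3 / 2)). split.
  { apply Rmin_pos; [lra|]. assert (0 < m ^ 3) by (apply pow_lt; lra). nra. }
  intros w Hw.
  pose proof (Rmin_l (m / 2) (eps * m ^ 3 / 2)).
  pose proof (Rmin_r (m / 2) (eps * m ^ 3 / 2)).
  assert (m / 2 <= Cmod w) as Hw2.
  { pose proof (Cmod_triangle_inv z (z - w)). rewrite (Cmod_minus_sym z w) in *.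
    replace (z - (z - w))%C with w in * by ring. unfold m in *; lra. }
  assert (w <> RtoC 0) as Nw by (apply Cmod_gt_0; lra).
  replace (/ w - / z - - / (z * z) * (w - z))%C
    with ((w - z) * (w - z) * / (w * (z * z)))%C by (field; auto).
  rewrite !Cmod_mult, Cmod_inv by (repeat apply Cmult_neq_0; auto).
  rewrite !Cmod_mult. fold m. set (t := Cmod (w - z)%C) in *.
  assert (0 <= t) by apply Cmod_ge_0.
  rewrite (Rmult_comm eps), Rmult_assoc. apply Rmult_le_compat_l; auto.
  assert (0 < m * m) by nra.
  assert (0 < Cmod w * (m * m)) by nra.
  apply Rmult_le_reg_r with (Cmod w * (m * m)); auto.
  rewrite Rmult_assoc, Rinv_l, Rmult_1_r by lra.
  apply Rle_trans with (eps * m ^ 3 / 2); [lra|].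
  replace (eps * m ^ 3 / 2) with (eps * ((m / 2) * (m * m))) by field.
  apply Rmult_le_compat_l; [lra|]. apply Rmult_le_compat_r; lra.
Qed.

(** * Paths in the plane *)

Definition pcont (u : R -> C) (t : R) : Prop :=
  forall eps, 0 < eps -> exists d, 0 < d /\
    forall s, Rabs (s - t) < d -> Cmod (u s - u t)%C < eps.

(** The velocity of a path is taken coordinatewise, so that the fundamental theorem
    of calculus for real functions applies to it directly; [pderiv_eps] restates it
    with the modulus, which is what the chain rule needs. *)
Definition pderiv (u : R -> C) (t : R) (v : C) : Prop :=
  is_derive (fun s => Re (u s)) t (Re v) /\ is_derive (fun s => Im (u s)) t (Im v).

Lemma is_derive_eps (f : R -> R) (x l : R) :
  is_derive f x l <-> forall eps, 0 < eps -> exists d, 0 < d /\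
    forall y, Rabs (y - x) < d -> Rabs (f y - f x - l * (y - x)) <= eps * Rabs (y - x).
Proof.
  split.
  - intros [_ H] eps He.
    specialize (H x (fun P HP => HP) (mkposreal eps He)).
    destruct H as [d Hd]. exists d. split; [apply cond_pos|].
    intros y Hy. specialize (Hd y Hy).
    unfold norm, minus, plus, opp, scal in Hd. simpl in Hd.
    unfold mult, abs in Hd. simpl in Hd.
    replace (f y - f x - l * (y - x)) with (f y + - f x + - ((y + - x) * l)) by ring.
    exact Hd.
  - intros H. split.
    + apply is_linear_scal_l.
    + intros z Hz.
      assert (z = x) as ->.
      { symmetry. apply is_filter_lim_locally_unique. exact Hz. }
      intros eps. destruct (H eps (cond_pos eps)) as [d [Hd Hd2]].
      exists (mkposreal d Hd). intros y Hy. specialize (Hd2 y Hy).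
      unfold norm, minus, plus, opp, scal. simpl. unfold mult, abs. simpl.
      replace (f y + - f x + - ((y + - x) * l)) with (f y - f x - l * (y - x)) by ring.
      exact Hd2.
Qed.

Lemma pderiv_eps (u : R -> C) (t : R) (v : C) :
  pderiv u t v <-> forall eps, 0 < eps -> exists d, 0 < d /\ forall s, Rabs (s - t) < d ->
      Cmod (u s - u t - v * RtoC (s - t))%C <= eps * Rabs (s - t).
Proof.
  assert (forall s, Re (u s - u t - v * RtoC (s - t))%C
     = Re (u s) - Re (u t) - Re v * (s - t)) as ER.
  { intros s. unfold Re, RtoC, Cmult, Cminus, Cplus, Copp. simpl. ring. }
  assert (forall s, Im (u s - u t - v * RtoC (s - t))%C
     = Im (u s) - Im (u t) - Im v * (s - t)) as EI.
  { intros s. unfold Im, RtoC, Cmult, Cminus, Cplus, Copp. simpl. ring. }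
  split.
  - intros [HR HI] eps He. rewrite is_derive_eps in HR, HI.
    destruct (HR (eps / 2)) as [d1 [Hd1 H1]]; [lra|].
    destruct (HI (eps / 2)) as [d2 [Hd2 H2]]; [lra|].
    exists (Rmin d1 d2). split; [apply Rmin_pos; auto|]. intros s Hs.
    pose proof (Rmin_l d1 d2). pose proof (Rmin_r d1 d2).
    specialize (H1 s ltac:(lra)). specialize (H2 s ltac:(lra)).
    eapply Rle_trans; [apply Cmod_le_abs|]. rewrite ER, EI. lra.
  - intros H. split; rewrite is_derive_eps; intros eps He;
      destruct (H eps He) as [d [Hd H1]]; exists d; (split; [auto|]);
      intros s Hs; specialize (H1 s Hs);
      [rewrite <- ER | rewrite <- EI]; eapply Rle_trans; try exact H1.
    + apply re_le_Cmod.
    + apply Im_le_Cmod.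
Qed.

(** The link between complex derivatives and real calculus: a holomorphic function
    carries a path of velocity [v] to a path of velocity [l * v]. *)
Lemma pderiv_comp (f : C -> C) (u : R -> C) (t : R) (l v : C) :
  cderiv f (u t) l -> pderiv u t v -> pderiv (fun s => f (u s)) t (l * v)%C.
Proof.
  intros Hf Hu. rewrite pderiv_eps in *. intros eps He.
  set (k := 1 + Cmod v).
  assert (0 < k) by (unfold k; pose proof (Cmod_ge_0 v); lra).
  set (kl := 1 + Cmod l).
  assert (0 < kl) by (unfold kl; pose proof (Cmod_ge_0 l); lra).
  destruct (Hf (eps / 2 / k)) as [d1 [Hd1 H1]].
  { apply Rdiv_lt_0_compat; lra. }
  destruct (Hu 1 Rlt_0_1) as [d3 [Hd3 H3]].
  destruct (Hu (eps / 2 / kl)) as [d4 [Hd4 H4]].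
  { apply Rdiv_lt_0_compat; lra. }
  exists (Rmin (d1 / k) (Rmin d3 d4)). split.
  { repeat apply Rmin_pos; auto. apply Rdiv_lt_0_compat; lra. }
  intros s Hs.
  pose proof (Rmin_l (d1 / k) (Rmin d3 d4)). pose proof (Rmin_r (d1 / k) (Rmin d3 d4)).
  pose proof (Rmin_l d3 d4). pose proof (Rmin_r d3 d4).
  specialize (H3 s ltac:(lra)). specialize (H4 s ltac:(lra)).
  assert (Cmod (u s - u t)%C <= k * Rabs (s - t)) as Hk.
  { replace (u s - u t)%C with ((u s - u t - v * RtoC (s - t)) + v * RtoC (s - t))%C by ring.
    eapply Rle_trans; [apply Cmod_triangle|]. rewrite Cmod_mult, Cmod_R. unfold k; lra. }
  assert (k * Rabs (s - t) < d1) as Hk1.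
  { apply Rlt_le_trans with (k * (d1 / k)); [apply Rmult_lt_compat_l; lra|].
    apply Req_le. field. lra. }
  specialize (H1 (u s) ltac:(lra)).
  replace (f (u s) - f (u t) - l * v * RtoC (s - t))%C
    with ((f (u s) - f (u t) - l * (u s - u t)) + l * (u s - u t - v * RtoC (s - t)))%C by ring.
  eapply Rle_trans; [apply Cmod_triangle|]. rewrite Cmod_mult.
  assert (eps / 2 / k * Cmod (u s - u t)%C <= eps / 2 * Rabs (s - t)).
  { replace (eps / 2 * Rabs (s - t)) with (eps / 2 / k * (k * Rabs (s - t))) by (field; lra).
    apply Rmult_le_compat_l; auto. apply Rlt_le. apply Rdiv_lt_0_compat; lra. }
  assert (Cmod l * Cmod (u s - u t - v * RtoC (s - t))%C <= eps / 2 * Rabs (s - t)).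
  { replace (eps / 2 * Rabs (s - t)) with (kl * (eps / 2 / kl * Rabs (s - t))) by (field; lra).
    apply Rmult_le_compat; auto using Cmod_ge_0. unfold kl; lra. }
  lra.
Qed.

Lemma pderiv_pcont u t v : pderiv u t v -> pcont u t.
Proof.
  rewrite pderiv_eps. intros H eps He.
  destruct (H 1 Rlt_0_1) as [d [Hd H1]].
  set (k := 1 + Cmod v).
  assert (0 < k) by (unfold k; pose proof (Cmod_ge_0 v); lra).
  exists (Rmin d (eps / k)). split.
  { apply Rmin_pos; auto. apply Rdiv_lt_0_compat; lra. }
  intros s Hs. pose proof (Rmin_l d (eps / k)). pose proof (Rmin_r d (eps / k)).
  specialize (H1 s ltac:(lra)).
  replace (u s - u t)%C with ((u s - u t - v * RtoC (s - t)) + v * RtoC (s - t))%C by ring.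
  eapply Rle_lt_trans; [apply Cmod_triangle|]. rewrite Cmod_mult, Cmod_R.
  apply Rle_lt_trans with (k * Rabs (s - t)); [unfold k; lra|].
  apply Rlt_le_trans with (k * (eps / k)); [apply Rmult_lt_compat_l; lra|].
  apply Req_le. field. lra.
Qed.

Lemma pcont_comp (f : C -> C) (u : R -> C) (t : R) :
  ccont f (u t) -> pcont u t -> pcont (fun s => f (u s)) t.
Proof.
  intros Hf Hu eps He. destruct (Hf eps He) as [d [Hd H]].
  destruct (Hu d Hd) as [d' [Hd' H']]. exists d'. split; auto.
Qed.

Lemma pcont_mult u v t : pcont u t -> pcont v t -> pcont (fun s => u s * v s)%C t.
Proof.
  intros Hu Hv eps He.
  set (k := 1 + Cmod (u t)). set (l := 1 + Cmod (v t)).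
  assert (1 <= k) by (unfold k; pose proof (Cmod_ge_0 (u t)); lra).
  assert (1 <= l) by (unfold l; pose proof (Cmod_ge_0 (v t)); lra).
  destruct (Hu (eps / 2 / l)) as [d1 [Hd1 H1]]; [apply Rdiv_lt_0_compat; lra|].
  destruct (Hv (Rmin 1 (eps / 2 / k))) as [d2 [Hd2 H2]].
  { apply Rmin_pos; [lra|apply Rdiv_lt_0_compat; lra]. }
  exists (Rmin d1 d2). split; [apply Rmin_pos; auto|]. intros s Hs.
  pose proof (Rmin_l d1 d2). pose proof (Rmin_r d1 d2).
  specialize (H1 s ltac:(lra)). specialize (H2 s ltac:(lra)).
  pose proof (Rmin_l 1 (eps / 2 / k)). pose proof (Rmin_r 1 (eps / 2 / k)).
  replace (u s * v s - u t * v t)%C with ((u s - u t) * v s + u t * (v s - v t))%C by ring.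
  eapply Rle_lt_trans; [apply Cmod_triangle|]. rewrite !Cmod_mult.
  assert (Cmod (v s) <= l).
  { replace (v s) with ((v s - v t) + v t)%C by ring.
    eapply Rle_trans; [apply Cmod_triangle|]. unfold l. lra. }
  assert (Cmod (u s - u t)%C * Cmod (v s) <= Cmod (u s - u t)%C * l).
  { apply Rmult_le_compat_l; auto using Cmod_ge_0. }
  assert (Cmod (u s - u t)%C * l < eps / 2).
  { apply Rlt_le_trans with (eps / 2 / l * l).
    - apply Rmult_lt_compat_r; lra.
    - apply Req_le. field. lra. }
  assert (Cmod (u t) * Cmod (v s - v t)%C <= eps / 2).
  { apply Rle_trans with (k * (eps / 2 / k)).
    - apply Rmult_le_compat; auto using Cmod_ge_0; unfold k in *; lra.
    - apply Req_le. field. lra. }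
  lra.
Qed.

Lemma pcont_const c t : pcont (fun _ => c) t.
Proof.
  intros eps He. exists 1. split; [lra|]. intros. rewrite Cmod_self_minus. exact He.
Qed.

Lemma pcont_plus u v t : pcont u t -> pcont v t -> pcont (fun s => u s + v s)%C t.
Proof.
  intros Hu Hv eps He.
  destruct (Hu (eps / 2)) as [d1 [Hd1 H1]]; [lra|].
  destruct (Hv (eps / 2)) as [d2 [Hd2 H2]]; [lra|].
  exists (Rmin d1 d2). split; [apply Rmin_pos; auto|]. intros s Hs.
  pose proof (Rmin_l d1 d2). pose proof (Rmin_r d1 d2).
  specialize (H1 s ltac:(lra)). specialize (H2 s ltac:(lra)).
  replace (u s + v s - (u t + v t))%C with ((u s - u t) + (v s - v t))%C by ring.
  eapply Rle_lt_trans; [apply Cmod_triangle|]. lra.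
Qed.

Lemma pcont_continuous_Re u t : pcont u t -> continuous (fun s => Re (u s)) t.
Proof.
  intros H. apply filterlim_locally. intros eps.
  destruct (H eps (cond_pos eps)) as [d [Hd H1]].
  exists (mkposreal d Hd). intros s Hs. specialize (H1 s Hs).
  eapply Rle_lt_trans; [|exact H1].
  eapply Rle_trans; [|apply re_le_Cmod].
  apply Req_le. unfold abs, minus, plus, opp; simpl. f_equal.
Qed.

Lemma pcont_continuous_Im u t : pcont u t -> continuous (fun s => Im (u s)) t.
Proof.
  intros H. apply filterlim_locally. intros eps.
  destruct (H eps (cond_pos eps)) as [d [Hd H1]].
  exists (mkposreal d Hd). intros s Hs. specialize (H1 s Hs).
  eapply Rle_lt_trans; [|exact H1].
  eapply Rle_trans; [|apply Im_le_Cmod].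
  apply Req_le. unfold abs, minus, plus, opp; simpl. f_equal.
Qed.

(** * Integrals of complex functions of a real variable *)

(** Endpoints may come in either order, as in oriented integrals. *)
Definition between (a b x : R) : Prop := Rmin a b <= x <= Rmax a b.

Lemma between_sub a b m n x : between a b m -> between a b n -> between m n x -> between a b x.
Proof.
  unfold between, Rmin, Rmax. destruct (Rle_dec a b); destruct (Rle_dec m n); lra.
Qed.

Lemma between_l a b : between a b a.
Proof. unfold between, Rmin, Rmax. destruct (Rle_dec a b); lra. Qed.

Lemma between_r a b : between a b b.
Proof. unfold between, Rmin, Rmax. destruct (Rle_dec a b); lra. Qed.

Lemma between_sym a b x : between a b x -> between b a x.
Proof. unfold between. rewrite Rmin_comm, Rmax_comm. auto. Qed.

Lemma between_le a b x : a <= b -> between a b x <-> a <= x <= b.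
Proof. intros H. unfold between. rewrite Rmin_left, Rmax_right by auto. tauto. Qed.

Lemma between_dist a b x y : between a b x -> between a b y -> Rabs (x - y) <= Rabs (b - a).
Proof.
  unfold between, Rmin, Rmax, Rabs.
  destruct (Rle_dec a b), (Rcase_abs (x - y)), (Rcase_abs (b - a)); lra.
Qed.

Definition CInt (u : R -> C) (a b : R) : C := RInt (V := C_R_CompleteNormedModule) u a b.

Definition pcont_on (u : R -> C) (a b : R) : Prop :=
  forall t, between a b t -> pcont u t.

Lemma CInt_correct u a b : pcont_on u a b ->
  is_RInt (V := C_R_CompleteNormedModule) u a b (CInt u a b).
Proof.
  intros H. apply (RInt_correct (V := C_R_CompleteNormedModule)).
  apply (ex_RInt_fct_extend_pair (U := R_NormedModule) (V := R_NormedModule)).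
  - apply (ex_RInt_continuous (V := R_CompleteNormedModule)).
    intros t Ht. apply pcont_continuous_Re. auto.
  - apply (ex_RInt_continuous (V := R_CompleteNormedModule)).
    intros t Ht. apply pcont_continuous_Im. auto.
Qed.

Lemma CInt_unique u a b l :
  is_RInt (V := C_R_CompleteNormedModule) u a b l -> CInt u a b = l.
Proof. apply (is_RInt_unique (V := C_R_CompleteNormedModule)). Qed.

Lemma pcont_on_sub u a b m n : pcont_on u a b -> between a b m -> between a b n ->
  pcont_on u m n.
Proof. intros H Hm Hn t Ht. apply H. apply (between_sub a b m n); auto. Qed.

Lemma CInt_ext u v a b : (forall t, between a b t -> u t = v t) ->
  CInt u a b = CInt v a b.
Proof. intros H. apply (RInt_ext (V := C_R_CompleteNormedModule)). intros. apply H. unfold between. lra. Qed.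

Lemma CInt_point u a : CInt u a a = RtoC 0.
Proof. apply (RInt_point (V := C_R_CompleteNormedModule)). Qed.

Lemma CInt_Chasles u a b c : pcont_on u a b -> pcont_on u b c ->
  CInt u a c = (CInt u a b + CInt u b c)%C.
Proof.
  intros H1 H2. apply CInt_unique.
  apply (is_RInt_Chasles (V := C_R_NormedModule) u a b c); apply CInt_correct; auto.
Qed.

Lemma CInt_swap u a b : pcont_on u a b -> CInt u b a = (- CInt u a b)%C.
Proof.
  intros H. apply CInt_unique.
  apply (is_RInt_swap (V := C_R_NormedModule)). apply CInt_correct. exact H.
Qed.

Lemma CInt_plus u v a b : pcont_on u a b -> pcont_on v a b ->
  CInt (fun t => u t + v t)%C a b = (CInt u a b + CInt v a b)%C.
Proof.
  intros H1 H2. apply CInt_unique.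
  apply (is_RInt_plus (V := C_R_NormedModule)); apply CInt_correct; auto.
Qed.

Lemma CInt_const (c : C) a b : CInt (fun _ => c) a b = (RtoC (b - a) * c)%C.
Proof.
  apply CInt_unique.
  replace (RtoC (b - a) * c)%C with (scal (V := C_R_NormedModule) (b - a) c).
  - apply (is_RInt_const (V := C_R_NormedModule)).
  - unfold scal. simpl. unfold prod_scal. simpl. unfold scal; simpl. unfold mult; simpl.
    destruct c as [x y]. unfold RtoC, Cmult. simpl. f_equal; ring.
Qed.

Lemma is_RInt_C_pair u a b (l : C) :
  is_RInt (fun t => Re (u t)) a b (Re l) -> is_RInt (fun t => Im (u t)) a b (Im l) ->
  CInt u a b = l.
Proof.
  intros H1 H2. apply CInt_unique. destruct l as [x y].
  apply (is_RInt_fct_extend_pair (U := R_NormedModule) (V := R_NormedModule)); assumption.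
Qed.

Lemma CInt_parts u a b : pcont_on u a b ->
  is_RInt (fun t => Re (u t)) a b (Re (CInt u a b)) /\
  is_RInt (fun t => Im (u t)) a b (Im (CInt u a b)).
Proof.
  intros H. apply CInt_correct in H. split.
  - apply (is_RInt_fct_extend_fst (U := R_NormedModule) (V := R_NormedModule)) in H. exact H.
  - apply (is_RInt_fct_extend_snd (U := R_NormedModule) (V := R_NormedModule)) in H. exact H.
Qed.

(** The integral is linear over [R] by construction; multiplication by a complex
    constant has to be expanded into coordinates. *)
Lemma CInt_scal (c : C) u a b : pcont_on u a b ->
  CInt (fun t => c * u t)%C a b = (c * CInt u a b)%C.
Proof.
  intros H. destruct (CInt_parts u a b H) as [H1 H2].
  destruct c as [x y]. apply is_RInt_C_pair.
  - apply is_RInt_ext with (fun t => minus (scal x (Re (u t))) (scal y (Im (u t)))).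
    { intros t _. unfold minus, plus, opp, scal, mult, Re, Im, Cmult; simpl.
      unfold mult; simpl. ring. }
    replace (Re ((x, y) * CInt u a b)%C)
      with (minus (scal x (Re (CInt u a b))) (scal y (Im (CInt u a b)))).
    + apply (is_RInt_minus (V := R_NormedModule)); apply (is_RInt_scal (V := R_NormedModule)); auto.
    + unfold minus, plus, opp, scal, mult, Re, Im, Cmult; simpl.
      unfold mult; simpl. ring.
  - apply is_RInt_ext with (fun t => plus (scal x (Im (u t))) (scal y (Re (u t)))).
    { intros t _. unfold minus, plus, opp, scal, mult, Re, Im, Cmult; simpl.
      unfold mult; simpl. ring. }
    replace (Im ((x, y) * CInt u a b)%C)
      with (plus (scal x (Im (CInt u a b))) (scal y (Re (CInt u a b)))).
    + apply (is_RInt_plus (V := R_NormedModule)); apply (is_RInt_scal (V := R_NormedModule)); auto.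
    + unfold minus, plus, opp, scal, mult, Re, Im, Cmult; simpl.
      unfold mult; simpl. ring.
Qed.

Lemma CInt_bound u a b M : pcont_on u a b ->
  (forall t, between a b t -> Cmod (u t) <= M) ->
  Cmod (CInt u a b) <= Rabs (b - a) * M.
Proof.
  intros H HM. rewrite Cmod_norm.
  apply (norm_RInt_le_const_abs (V := C_R_NormedModule) u); [|apply CInt_correct; auto].
  intros t Ht. specialize (HM t Ht). rewrite Cmod_norm in HM. exact HM.
Qed.

(** Continuity on a segment gives a bound, because the integrability that it implies
    does. *)
Lemma CInt_bounded u a b : pcont_on u a b ->
  exists M, forall t, between a b t -> Cmod (u t) <= M.
Proof.
  intros H. apply CInt_correct in H.
  destruct (ex_RInt_ub (V := C_R_NormedModule) u a b (ex_intro _ _ H)) as [M HM].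
  exists M. intros t Ht. rewrite Cmod_norm. apply HM. exact Ht.
Qed.

Lemma CInt_FTC U u a b :
  (forall t, between a b t -> pderiv U t (u t)) ->
  pcont_on u a b -> CInt u a b = (U b - U a)%C.
Proof.
  intros H Hc. apply is_RInt_C_pair.
  - apply (is_RInt_derive (V := R_CompleteNormedModule) (fun t => Re (U t))).
    + intros t Ht. apply H. exact Ht.
    + intros t Ht. apply pcont_continuous_Re. auto.
  - apply (is_RInt_derive (V := R_CompleteNormedModule) (fun t => Im (U t))).
    + intros t Ht. apply H. exact Ht.
    + intros t Ht. apply pcont_continuous_Im. auto.
Qed.

(** * Integrals around rectangles *)

Definition in_rect (a b c d : R) (z : C) : Prop :=
  between a b (fst z) /\ between c d (snd z).

Definition cont_rect (g : C -> C) (a b c d : R) : Prop :=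
  forall z, in_rect a b c d z -> ccont g z.

(** The integral of [g dz] around the boundary of the rectangle [a, b] x [c, d]. Opposite
    corners may come in any order, the sign following the orientation; this turns the
    later case distinctions into identities between signed integrals. *)
Definition rectI (g : C -> C) (a b c d : R) : C :=
  (CInt (fun x => g (x, c)) a b + Ci * CInt (fun y => g (b, y)) c d
   - CInt (fun x => g (x, d)) a b - Ci * CInt (fun y => g (a, y)) c d)%C.

Lemma Cmod_hor x x' y : Cmod ((x, y) - (x', y))%C = Rabs (x - x').
Proof.
  replace ((x, y) - (x', y))%C with (RtoC (x - x')).
  - apply Cmod_R.
  - unfold RtoC, Cminus, Cplus, Copp. simpl. f_equal; ring.
Qed.

Lemma Cmod_ver x y y' : Cmod ((x, y) - (x, y'))%C = Rabs (y - y').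
Proof.
  replace ((x, y) - (x, y'))%C with (Ci * RtoC (y - y'))%C.
  - rewrite Cmod_mult, Cmod_Ci, Cmod_R. ring.
  - unfold RtoC, Ci, Cmult, Cminus, Cplus, Copp. simpl. f_equal; ring.
Qed.

Lemma pcont_hor g x y : ccont g (x, y) -> pcont (fun s => g (s, y)) x.
Proof.
  intros H. apply (pcont_comp g (fun s => (s, y)) x H).
  intros eps He. exists eps. split; auto. intros s Hs. rewrite Cmod_hor. exact Hs.
Qed.

Lemma pcont_ver g x y : ccont g (x, y) -> pcont (fun s => g (x, s)) y.
Proof.
  intros H. apply (pcont_comp g (fun s => (x, s)) y H).
  intros eps He. exists eps. split; auto. intros s Hs. rewrite Cmod_ver. exact Hs.
Qed.

Lemma cont_rect_hor g a b c d y : cont_rect g a b c d -> between c d y ->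
  pcont_on (fun x => g (x, y)) a b.
Proof. intros H Hy t Ht. apply pcont_hor. apply H. split; auto. Qed.

Lemma cont_rect_ver g a b c d x : cont_rect g a b c d -> between a b x ->
  pcont_on (fun y => g (x, y)) c d.
Proof. intros H Hx t Ht. apply pcont_ver. apply H. split; auto. Qed.

Lemma cont_rect_sub g a b c d a' b' c' d' : cont_rect g a b c d ->
  between a b a' -> between a b b' -> between c d c' -> between c d d' ->
  cont_rect g a' b' c' d'.
Proof.
  intros H Ha Hb Hc Hd z [H1 H2]. apply H. split.
  - apply (between_sub a b a' b'); auto.
  - apply (between_sub c d c' d'); auto.
Qed.

Lemma rectI_split_h g a m b c d : cont_rect g a b c d -> between a b m ->
  rectI g a b c d = (rectI g a m c d + rectI g m b c d)%C.
Proof.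
  intros H Hm. unfold rectI.
  pose proof (cont_rect_hor g a b c d c H (between_l _ _)) as H1.
  pose proof (cont_rect_hor g a b c d d H (between_r _ _)) as H2.
  rewrite (CInt_Chasles (fun x => g (x, c)) a m b);
    [|eapply pcont_on_sub; eauto using between_l, between_r..].
  rewrite (CInt_Chasles (fun x => g (x, d)) a m b);
    [|eapply pcont_on_sub; eauto using between_l, between_r..].
  ring.
Qed.

Lemma rectI_split_v g a b c n d : cont_rect g a b c d -> between c d n ->
  rectI g a b c d = (rectI g a b c n + rectI g a b n d)%C.
Proof.
  intros H Hm. unfold rectI.
  pose proof (cont_rect_ver g a b c d a H (between_l _ _)) as H1.
  pose proof (cont_rect_ver g a b c d b H (between_r _ _)) as H2.
  rewrite (CInt_Chasles (fun y => g (a, y)) c n d);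
    [|eapply pcont_on_sub; eauto using between_l, between_r..].
  rewrite (CInt_Chasles (fun y => g (b, y)) c n d);
    [|eapply pcont_on_sub; eauto using between_l, between_r..].
  ring.
Qed.

Lemma rectI_swap_h g a b c d : cont_rect g a b c d ->
  rectI g b a c d = (- rectI g a b c d)%C.
Proof.
  intros H. unfold rectI.
  rewrite (CInt_swap (fun x => g (x, c)) a b), (CInt_swap (fun x => g (x, d)) a b).
  - ring.
  - apply (cont_rect_hor g a b c d d H (between_r _ _)).
  - apply (cont_rect_hor g a b c d c H (between_l _ _)).
Qed.

Lemma rectI_swap_v g a b c d : cont_rect g a b c d ->
  rectI g a b d c = (- rectI g a b c d)%C.
Proof.
  intros H. unfold rectI.
  rewrite (CInt_swap (fun y => g (a, y)) c d), (CInt_swap (fun y => g (b, y)) c d).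
  - ring.
  - apply (cont_rect_ver g a b c d b H (between_r _ _)).
  - apply (cont_rect_ver g a b c d a H (between_l _ _)).
Qed.

Lemma rectI_plus f g a b c d : cont_rect f a b c d -> cont_rect g a b c d ->
  rectI (fun z => f z + g z)%C a b c d = (rectI f a b c d + rectI g a b c d)%C.
Proof.
  intros Hf Hg. unfold rectI.
  rewrite !CInt_plus;
    eauto using cont_rect_hor, cont_rect_ver, between_l, between_r.
  ring.
Qed.

Lemma rectI_ext f g a b c d : (forall z, in_rect a b c d z -> f z = g z) ->
  rectI f a b c d = rectI g a b c d.
Proof.
  intros H. unfold rectI.
  rewrite (CInt_ext (fun x => f (x, c)) (fun x => g (x, c))).
  2: { intros; apply H; split; simpl; auto using between_l. }
  rewrite (CInt_ext (fun x => f (x, d)) (fun x => g (x, d))).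
  2: { intros; apply H; split; simpl; auto using between_r. }
  rewrite (CInt_ext (fun y => f (a, y)) (fun y => g (a, y))).
  2: { intros; apply H; split; simpl; auto using between_l. }
  rewrite (CInt_ext (fun y => f (b, y)) (fun y => g (b, y))).
  2: { intros; apply H; split; simpl; auto using between_r. }
  reflexivity.
Qed.

Lemma rectI_bound g a b c d M : cont_rect g a b c d ->
  (forall z, in_rect a b c d z -> Cmod (g z) <= M) ->
  Cmod (rectI g a b c d) <= 2 * (Rabs (b - a) + Rabs (d - c)) * M.
Proof.
  intros Hc HM. unfold rectI.
  assert (Cmod (CInt (fun x => g (x, c)) a b) <= Rabs (b - a) * M).
  { apply CInt_bound; [eauto using cont_rect_hor, between_l|].
    intros; apply HM; split; simpl; auto using between_l. }
  assert (Cmod (CInt (fun x => g (x, d)) a b) <= Rabs (b - a) * M).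
  { apply CInt_bound; [eauto using cont_rect_hor, between_r|].
    intros; apply HM; split; simpl; auto using between_r. }
  assert (Cmod (CInt (fun y => g (a, y)) c d) <= Rabs (d - c) * M).
  { apply CInt_bound; [eauto using cont_rect_ver, between_l|].
    intros; apply HM; split; simpl; auto using between_l. }
  assert (Cmod (CInt (fun y => g (b, y)) c d) <= Rabs (d - c) * M).
  { apply CInt_bound; [eauto using cont_rect_ver, between_r|].
    intros; apply HM; split; simpl; auto using between_r. }
  eapply Rle_trans; [apply Cmod_triangle_minus|].
  eapply Rle_trans; [apply Rplus_le_compat_r; apply Cmod_triangle_minus|].
  eapply Rle_trans; [apply Rplus_le_compat_r; apply Rplus_le_compat_r; apply Cmod_triangle|].
  rewrite !Cmod_mult, !Cmod_Ci. lra.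
Qed.

Lemma pderiv_hor y t : pderiv (fun x => (x, y)) t (RtoC 1).
Proof.
  split; simpl.
  - apply (is_derive_id (K := R_AbsRing)).
  - apply (is_derive_const (K := R_AbsRing) (V := R_NormedModule)).
Qed.

Lemma pderiv_ver x t : pderiv (fun y => (x, y)) t Ci.
Proof.
  split; simpl.
  - apply (is_derive_const (K := R_AbsRing) (V := R_NormedModule)).
  - apply (is_derive_id (K := R_AbsRing)).
Qed.

Lemma CInt_hor_primitive G g a b y :
  (forall x, between a b x -> cderiv G (x, y) (g (x, y)) /\ ccont g (x, y)) ->
  CInt (fun x => g (x, y)) a b = (G (b, y) - G (a, y))%C.
Proof.
  intros H. apply (CInt_FTC (fun x => G (x, y))).
  - intros t Ht. destruct (H t Ht) as [H1 _].
    pose proof (pderiv_comp G _ t _ _ H1 (pderiv_hor y t)) as H2.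
    rewrite Cmult_1_r in H2. exact H2.
  - intros t Ht. apply pcont_hor. apply H. exact Ht.
Qed.

Lemma CInt_ver_primitive G g c d x :
  (forall y, between c d y -> cderiv G (x, y) (g (x, y)) /\ ccont g (x, y)) ->
  (Ci * CInt (fun y => g (x, y)) c d = G (x, d) - G (x, c))%C.
Proof.
  intros H. assert (pcont_on (fun y => g (x, y)) c d) as Hc.
  { intros t Ht. apply pcont_ver. apply H. exact Ht. }
  rewrite <- CInt_scal by exact Hc.
  apply (CInt_FTC (fun y => G (x, y))).
  - intros t Ht. destruct (H t Ht) as [H1 _].
    pose proof (pderiv_comp G _ t _ _ H1 (pderiv_ver x t)) as H2.
    rewrite Cmult_comm in H2. exact H2.
  - intros t Ht. apply pcont_mult; [apply pcont_const|apply Hc; exact Ht].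
Qed.

(** The four sides contribute increments of the primitive that cancel around the
    boundary. *)
Lemma rectI_primitive G g a b c d :
  (forall z, in_rect a b c d z -> cderiv G z (g z) /\ ccont g z) ->
  rectI g a b c d = RtoC 0.
Proof.
  intros H. unfold rectI.
  rewrite (CInt_hor_primitive G g a b c), (CInt_hor_primitive G g a b d),
    (CInt_ver_primitive G g c d a), (CInt_ver_primitive G g c d b).
  - ring.
  - intros; apply H; split; simpl; auto using between_r.
  - intros; apply H; split; simpl; auto using between_l.
  - intros; apply H; split; simpl; auto using between_r.
  - intros; apply H; split; simpl; auto using between_l.
Qed.

(** * Bisection of rectangles *)

Definition half_of (a b a' b' : R) : Prop :=
  (a' = a /\ b' = (a + b) / 2) \/ (a' = (a + b) / 2 /\ b' = b).

Lemma half_of_spec a b a' b' : a <= b -> half_of a b a' b' ->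
  a <= a' /\ a' <= b' /\ b' <= b /\ b' - a' = (b - a) / 2.
Proof. intros H [[-> ->]|[-> ->]]; lra. Qed.

(** Bisection in one coordinate: the lengths are halved at each step, and the
    supremum of the left endpoints lies in all the intervals. *)
Lemma nested_halves (a b : nat -> R) :
  a 0%nat <= b 0%nat ->
  (forall n, half_of (a n) (b n) (a (S n)) (b (S n))) ->
  (forall n, b n - a n = (b 0%nat - a 0%nat) / 2 ^ n) /\
  exists x, forall n, a 0%nat <= a n /\ a n <= x <= b n /\ b n <= b 0%nat.
Proof.
  intros H0 H.
  assert (forall n, a n <= b n) as Hab.
  { induction n; auto. apply (half_of_spec _ _ _ _ IHn (H n)). }
  assert (forall n, a n <= a (S n) /\ b (S n) <= b n /\ b (S n) - a (S n) = (b n - a n) / 2) as Hs.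
  { intros n. pose proof (half_of_spec _ _ _ _ (Hab n) (H n)). lra. }
  split.
  { induction n.
    - simpl. field.
    - destruct (Hs n) as [_ [_ E]]. rewrite E, IHn. simpl. field.
      apply pow_nonzero. lra. }
  assert (forall n k, a n <= a (n + k)%nat /\ b (n + k)%nat <= b n) as Hmon.
  { intros n k. induction k.
    - rewrite Nat.add_0_r. lra.
    - replace (n + S k)%nat with (S (n + k)) by lia. pose proof (Hs (n + k)%nat). lra. }
  assert (forall n m, a n <= b m) as Hcross.
  { intros n m. pose proof (Hmon n m) as [H1 _]. pose proof (Hmon m n) as [_ H2].
    pose proof (Hab (n + m)%nat). replace (m + n)%nat with (n + m)%nat in H2 by lia. lra. }
  destruct (completeness (fun x => exists n, x = a n)) as [x [Hx1 Hx2]].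
  - exists (b 0%nat). intros x [n ->]. apply Hcross.
  - exists (a 0%nat). exists 0%nat. reflexivity.
  - exists x. intros n. repeat split.
    + apply (Hmon 0%nat n).
    + apply Hx1. exists n. reflexivity.
    + apply Hx2. intros y [m ->]. apply Hcross.
    + apply (Hmon 0%nat n).
Qed.

(** A property of rectangles that passes from the four quarters to the whole and holds
    for all small rectangles around each point holds for the whole rectangle. Otherwise
    there would be a sequence of bad rectangles, each a quarter of the one before,
    shrinking to a point, around which small rectangles are good. The small rectangles
    must contain the point: the linear approximation of a function at that point is only
    good at the scale of the distance to it. *)
Lemma rect_bisection (P : R -> R -> R -> R -> Prop) (a b c d : R) :
  a <= b -> c <= d ->
  (forall a' b' c' d', a <= a' <= b' -> b' <= b -> c <= c' <= d' -> d' <= d ->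
     (forall a2 b2 c2 d2, half_of a' b' a2 b2 -> half_of c' d' c2 d2 -> P a2 b2 c2 d2) ->
     P a' b' c' d') ->
  (forall x y, a <= x <= b -> c <= y <= d -> exists delta, 0 < delta /\
     forall a' b' c' d', a <= a' <= x -> x <= b' <= b -> c <= c' <= y -> y <= d' <= d ->
       b' - a' < delta -> d' - c' < delta -> P a' b' c' d') ->
  P a b c d.
Proof.
  intros Hab Hcd Hind Hloc. apply NNPP. intros HP.
  set (bad := fun r : (R * R) * (R * R) =>
    a <= fst (fst r) <= snd (fst r) /\ snd (fst r) <= b /\
    c <= fst (snd r) <= snd (snd r) /\ snd (snd r) <= d /\
    ~ P (fst (fst r)) (snd (fst r)) (fst (snd r)) (snd (snd r))).
  set (child := fun r r' : (R * R) * (R * R) =>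
    half_of (fst (fst r)) (snd (fst r)) (fst (fst r')) (snd (fst r')) /\
    half_of (fst (snd r)) (snd (snd r)) (fst (snd r')) (snd (snd r'))).
  assert (forall r, bad r -> exists r', bad r' /\ child r r') as Hstep.
  { intros [[a1 b1] [c1 d1]] (H1 & H2 & H3 & H4 & H5). simpl in *.
    apply NNPP. intros Hn. apply H5. apply Hind; auto.
    intros a2 b2 c2 d2 Hh1 Hh2. apply NNPP. intros Hn2. apply Hn.
    exists ((a2, b2), (c2, d2)). unfold bad, child. simpl.
    pose proof (half_of_spec a1 b1 a2 b2 ltac:(lra) Hh1).
    pose proof (half_of_spec c1 d1 c2 d2 ltac:(lra) Hh2).
    repeat split; auto; lra. }
  set (next := fun r => match excluded_middle_informative (bad r) with
     | left Hb => proj1_sig (constructive_indefinite_description _ (Hstep r Hb))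
     | right _ => r end).
  assert (forall r, bad r -> bad (next r) /\ child r (next r)) as Hnext.
  { intros r Hb. unfold next. destruct (excluded_middle_informative (bad r)); [|tauto].
    destruct (constructive_indefinite_description _ _); auto. }
  set (seq := fix seq n := match n with O => ((a, b), (c, d)) | S n => next (seq n) end).
  assert (forall n, bad (seq n)) as Hbad.
  { induction n.
    - simpl. unfold bad. simpl. repeat split; auto; lra.
    - simpl. apply Hnext. exact IHn. }
  destruct (nested_halves (fun n => fst (fst (seq n))) (fun n => snd (fst (seq n)))) as [Hw1 [x Hx]].
  { simpl. exact Hab. }
  { intros n. simpl. apply Hnext. apply Hbad. }
  destruct (nested_halves (fun n => fst (snd (seq n))) (fun n => snd (snd (seq n)))) as [Hw2 [y Hy]].
  { simpl. exact Hcd. }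
  { intros n. simpl. apply Hnext. apply Hbad. }
  simpl in Hw1, Hw2, Hx, Hy.
  destruct (Hloc x y) as [delta [Hd Hdel]].
  { pose proof (Hx 0%nat). simpl in *. lra. }
  { pose proof (Hy 0%nat). simpl in *. lra. }
  (* K exceeds both sides, so halving it n times makes both sides small *)
  set (K := 1 + (b - a) + (d - c)).
  assert (exists n, K / 2 ^ n < delta) as [n Hn].
  { destruct (pow_lt_1_zero (/ 2) ltac:(rewrite Rabs_pos_eq; lra) (delta / K)) as [n Hn].
    - apply Rdiv_lt_0_compat; unfold K; lra.
    - exists n. specialize (Hn n (le_n _)).
      rewrite Rabs_pos_eq in Hn by (apply pow_le; lra).
      rewrite pow_inv in Hn. unfold Rdiv.
      apply Rmult_lt_compat_l with (r := K) in Hn; [|unfold K; lra].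
      replace (K * (delta / K)) with delta in Hn by (field; unfold K; lra). exact Hn. }
  assert (0 < / 2 ^ n) by (apply Rinv_0_lt_compat, pow_lt; lra).
  destruct (Hbad n) as (H1 & H2 & H3 & H4 & H5). apply H5.
  pose proof (Hx n). pose proof (Hy n).
  apply Hdel; try lra.
  - rewrite Hw1. eapply Rle_lt_trans; [|exact Hn].
    apply Rmult_le_compat_r; unfold K; lra.
  - rewrite Hw2. eapply Rle_lt_trans; [|exact Hn].
    apply Rmult_le_compat_r; unfold K; lra.
Qed.

(** * Goursat's theorem *)

Lemma nonpos_of_le_eps_mult (x K : R) : (forall eps, 0 < eps -> x <= eps * K) -> x <= 0.
Proof.
  intros H. destruct (Rle_dec x 0); auto. exfalso.
  assert (0 < K) as HK.
  { specialize (H 1 Rlt_0_1). lra. }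
  specialize (H (x / (2 * K)) ltac:(apply Rdiv_lt_0_compat; lra)).
  replace (x / (2 * K) * K) with (x / 2) in H by (field; lra). lra.
Qed.

Lemma in_rect_dist a b c d z p : in_rect a b c d z -> in_rect a b c d p ->
  Cmod (z - p)%C <= Rabs (b - a) + Rabs (d - c).
Proof.
  intros [H1 H2] [H3 H4]. eapply Rle_trans; [apply Cmod_le_abs|].
  apply Rplus_le_compat; apply between_dist; auto.
Qed.

(** An affine function has a quadratic primitive. *)
Lemma rectI_affine p u l a b c d : rectI (fun w => u + l * (w - p))%C a b c d = RtoC 0.
Proof.
  apply (rectI_primitive (fun w => u * w + l / 2 * ((w - p) * (w - p)))%C).
  intros z _. split.
  - replace (u + l * (z - p))%C with (u * 1 + l / 2 * (2 * (z - p) * 1))%C by now field.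
    apply (cderiv_plus (fun w => u * w)%C (fun w => l / 2 * ((w - p) * (w - p)))%C).
    + apply cderiv_scal, cderiv_id.
    + apply (cderiv_scal _ (fun w => (w - p) * (w - p))%C).
      apply (cderiv_comp (fun w => w * w)%C (fun w => w - p)%C).
      * apply cderiv_sqr.
      * apply cderiv_minus_const.
  - apply cderiv_ccont with l. apply cderiv_affine.
Qed.

(** Goursat: the inequality |integral| <= eps * (width^2 + height^2) is additive under
    quartering, since the four quarters have the same sum of squared sides as the whole.
    On small rectangles around [p] it holds because the affine part of [g] at [p]
    integrates to 0 and the rest is o(diameter) on a boundary of length O(diameter). *)
Lemma goursat_le g a b c d : a <= b -> c <= d ->
  (forall z, in_rect a b c d z -> exists l, cderiv g z l) ->
  rectI g a b c d = RtoC 0.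
Proof.
  intros Hab Hcd Hg.
  assert (cont_rect g a b c d) as Hcont.
  { intros z Hz. destruct (Hg z Hz) as [l Hl]. eapply cderiv_ccont; eauto. }
  apply Cmod_eq_0. apply Rle_antisym; [|apply Cmod_ge_0].
  apply (nonpos_of_le_eps_mult _ ((b - a)^2 + (d - c)^2)). intros eps He.
  apply (rect_bisection (fun a b c d => Cmod (rectI g a b c d) <= eps * ((b - a)^2 + (d - c)^2)));
    auto.
  - intros a' b' c' d' H1 H2 H3 H4 H.
    set (m := (a' + b') / 2). set (n := (c' + d') / 2).
    assert (cont_rect g a' b' c' d') as Hc'.
    { apply (cont_rect_sub g a b c d); auto; apply between_le; lra. }
    rewrite (rectI_split_h g a' m b' c' d'); auto; [|apply between_le; unfold m; lra].
    assert (cont_rect g a' m c' d').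
    { apply (cont_rect_sub g a b c d); auto; apply between_le; unfold m; lra. }
    assert (cont_rect g m b' c' d').
    { apply (cont_rect_sub g a b c d); auto; apply between_le; unfold m; lra. }
    rewrite (rectI_split_v g a' m c' n d'); auto; [|apply between_le; unfold n; lra].
    rewrite (rectI_split_v g m b' c' n d'); auto; [|apply between_le; unfold n; lra].
    assert (half_of a' b' a' m) by (left; auto).
    assert (half_of a' b' m b') by (right; auto).
    assert (half_of c' d' c' n) by (left; auto).
    assert (half_of c' d' n d') by (right; auto).
    pose proof (H a' m c' n ltac:(auto) ltac:(auto)).
    pose proof (H a' m n d' ltac:(auto) ltac:(auto)).
    pose proof (H m b' c' n ltac:(auto) ltac:(auto)).
    pose proof (H m b' n d' ltac:(auto) ltac:(auto)).
    eapply Rle_trans; [apply Cmod_triangle|].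
    eapply Rle_trans; [apply Rplus_le_compat; apply Cmod_triangle|].
    replace (eps * ((b' - a') ^ 2 + (d' - c') ^ 2)) with
      (eps * ((m - a') ^ 2 + (n - c') ^ 2) + eps * ((m - a') ^ 2 + (d' - n) ^ 2)
      + (eps * ((b' - m) ^ 2 + (n - c') ^ 2) + eps * ((b' - m) ^ 2 + (d' - n) ^ 2)))
      by (unfold m, n; field).
    lra.
  - intros x y Hx Hy. set (p := (x, y) : C).
    assert (in_rect a b c d p) as Hp by (split; apply between_le; auto).
    destruct (Hg p Hp) as [l Hl].
    destruct (Hl (eps / 4) ltac:(lra)) as [e [He1 He2]].
    exists (e / 2). split; [lra|].
    intros a' b' c' d' H1 H2 H3 H4 H5 H6.
    assert (forall z, in_rect a' b' c' d' z -> in_rect a b c d z) as Hsub.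
    { intros z [Z1 Z2]. apply (between_le a' b' _ ltac:(lra)) in Z1.
      apply (between_le c' d' _ ltac:(lra)) in Z2.
      split; apply between_le; lra. }
    assert (cont_rect g a' b' c' d') as Hc'.
    { intros z Hz. apply Hcont. auto. }
    (* g is split into its affine part at p and a remainder *)
    set (lin := fun w => (g p + l * (w - p))%C).
    set (rem := fun w => (g w + (- (1)) * lin w)%C).
    assert (cont_rect rem a' b' c' d') as Hr.
    { intros z Hz. destruct (Hg z (Hsub z Hz)) as [lz Hlz].
      eapply cderiv_ccont. unfold rem. apply cderiv_plus; [exact Hlz|].
      apply cderiv_scal. apply cderiv_affine. }
    assert (rectI g a' b' c' d' = rectI rem a' b' c' d') as E.
    { transitivity (rectI (fun w => rem w + lin w)%C a' b' c' d').
      - apply rectI_ext. intros z _. unfold rem. ring.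
      - rewrite rectI_plus; auto.
        + unfold lin. rewrite rectI_affine. ring.
        + intros z _. eapply cderiv_ccont. apply cderiv_affine. }
    rewrite E.
    set (s := (b' - a') + (d' - c')).
    assert (0 <= s) by (unfold s; lra).
    eapply Rle_trans.
    + apply (rectI_bound rem a' b' c' d' (eps / 4 * s)); auto.
      intros z Hz.
      assert (Cmod (z - p)%C <= s) as Hs.
      { pose proof (in_rect_dist a' b' c' d' z p Hz) as D.
        rewrite !Rabs_pos_eq in D by lra. unfold s. apply D.
        split; apply between_le; simpl; lra. }
      replace (rem z) with (g z - g p - l * (z - p))%C by (unfold rem, lin; ring).
      eapply Rle_trans; [apply He2; unfold s in *; lra|].
      apply Rmult_le_compat_l; lra.
    + rewrite !Rabs_pos_eq by lra. fold s.
      assert (s * s <= 2 * ((b' - a') ^ 2 + (d' - c') ^ 2)).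
      { unfold s. pose proof (pow2_ge_0 ((b' - a') - (d' - c'))). lra. }
      replace (2 * s * (eps / 4 * s)) with (eps * (s * s / 2)) by field.
      apply Rmult_le_compat_l; lra.
Qed.

Lemma in_rect_swap_h a b c d z : in_rect a b c d z -> in_rect b a c d z.
Proof. intros [H1 H2]. split; auto using between_sym. Qed.

Lemma in_rect_swap_v a b c d z : in_rect a b c d z -> in_rect a b d c z.
Proof. intros [H1 H2]. split; auto using between_sym. Qed.

(** Reduces a rectangle of arbitrary orientation to the positively oriented one. *)
Lemma rectI_swap_0 g a b c d : cont_rect g a b c d ->
  rectI g (Rmin a b) (Rmax a b) (Rmin c d) (Rmax c d) = RtoC 0 -> rectI g a b c d = RtoC 0.
Proof.
  intros Hc. unfold Rmin, Rmax.
  assert (cont_rect g b a c d) by (intros z Hz; apply Hc, in_rect_swap_h, Hz).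
  assert (cont_rect g b a d c) by (intros z Hz; apply Hc, in_rect_swap_h, in_rect_swap_v, Hz).
  assert (cont_rect g a b d c) by (intros z Hz; apply Hc, in_rect_swap_v, Hz).
  destruct (Rle_dec a b), (Rle_dec c d); intros E; auto.
  - rewrite (rectI_swap_v g a b d c), E by auto. ring.
  - rewrite (rectI_swap_h g b a c d), E by auto. ring.
  - rewrite (rectI_swap_h g b a c d), (rectI_swap_v g b a d c), E by auto. ring.
Qed.

Lemma goursat g a b c d :
  (forall z, in_rect a b c d z -> exists l, cderiv g z l) ->
  rectI g a b c d = RtoC 0.
Proof.
  intros Hg. apply rectI_swap_0.
  { intros z Hz. destruct (Hg z Hz) as [l Hl]. eapply cderiv_ccont; eauto. }
  assert (Rmin a b <= Rmax a b) by apply Rminmax.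
  assert (Rmin c d <= Rmax c d) by apply Rminmax.
  apply goursat_le; auto.
  intros z [H1 H2]. apply (between_le (Rmin a b)) in H1; auto.
  apply (between_le (Rmin c d)) in H2; auto. apply Hg. split; auto.
Qed.

Lemma rectI_flat_h g a c d : rectI g a a c d = RtoC 0.
Proof. unfold rectI. rewrite !CInt_point. ring. Qed.

Lemma rectI_flat_v g a b c : rectI g a b c c = RtoC 0.
Proof. unfold rectI. rewrite !CInt_point. ring. Qed.

Lemma not_between_shrunk x b s : x <> b -> 0 < s < 1 -> ~ between (x + s * (b - x)) b x.
Proof.
  intros H Hs. unfold between, Rmin, Rmax. destruct (Rle_dec _ b); nra.
Qed.

Lemma between_shrunk x b s : 0 <= s <= 1 -> between x b (x + s * (b - x)).
Proof.
  intros Hs. unfold between, Rmin, Rmax. destruct (Rle_dec x b); nra.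
Qed.

(** When the exceptional point is a corner, cutting off a small rectangle at that corner
    leaves two pieces to which Goursat's theorem applies; the small one contributes
    little because [g] is bounded near the point. *)
Lemma goursat_except_corner g x b y d :
  cont_rect g x b y d ->
  (forall z, in_rect x b y d z -> z <> (x, y) -> exists l, cderiv g z l) ->
  rectI g x b y d = RtoC 0.
Proof.
  intros Hc Hg.
  destruct (Req_dec x b) as [->|Hxb]; [apply rectI_flat_h|].
  destruct (Req_dec y d) as [->|Hyd]; [apply rectI_flat_v|].
  set (p := (x, y) : C) in *.
  assert (in_rect x b y d p) as Hp by (split; apply between_l).
  set (L := Rabs (b - x) + Rabs (d - y)).
  assert (0 < L) as HL.
  { unfold L. pose proof (Rabs_pos_lt (b - x) ltac:(lra)).
    pose proof (Rabs_pos_lt (d - y) ltac:(lra)). lra. }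
  apply Cmod_eq_0. apply Rle_antisym; [|apply Cmod_ge_0].
  apply (nonpos_of_le_eps_mult _ (2 * L * (1 + Cmod (g p)))). intros eps He.
  destruct (Hc p Hp 1 Rlt_0_1) as [dl [Hd1 Hd2]].
  set (s := Rmin (Rmin eps (1 / 2)) (dl / (2 * L))).
  assert (0 < dl / (2 * L)) by (apply Rdiv_lt_0_compat; lra).
  assert (0 < s <= eps /\ s <= 1 / 2 /\ s * L < dl) as (Hs1 & Hs2 & Hs3).
  { assert (s <= Rmin eps (1 / 2)) by apply Rmin_l.
    assert (s <= dl / (2 * L)) by apply Rmin_r.
    pose proof (Rmin_l eps (1 / 2)). pose proof (Rmin_r eps (1 / 2)).
    repeat split; try lra.
    - unfold s. repeat apply Rmin_pos; lra.
    - apply Rle_lt_trans with (dl / (2 * L) * L).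
      + apply Rmult_le_compat_r; lra.
      + replace (dl / (2 * L) * L) with (dl / 2) by (field; lra). lra. }
  set (m := x + s * (b - x)). set (n := y + s * (d - y)).
  assert (between x b m) as Hm by (apply between_shrunk; lra).
  assert (between y d n) as Hn by (apply between_shrunk; lra).
  rewrite (rectI_split_h g x m b y d) by auto.
  assert (cont_rect g x m y d) as Hc1.
  { apply (cont_rect_sub g x b y d); auto using between_l, between_r. }
  rewrite (rectI_split_v g x m y n d) by auto.
  rewrite (goursat g m b y d), (goursat g x m n d).
  2: { intros z [Z1 Z2]. apply Hg.
       - split; [apply (between_sub x b x m)|apply (between_sub y d n d)]; auto using between_l, between_r.
       - intros ->. apply (not_between_shrunk y d s) in Z2; auto. lra. }
  2: { intros z [Z1 Z2]. apply Hg.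
       - split; [apply (between_sub x b m b)|apply (between_sub y d y d)]; auto using between_l, between_r.
       - intros ->. apply (not_between_shrunk x b s) in Z1; auto. lra. }
  rewrite !Cplus_0_r.
  assert (cont_rect g x m y n) as Hc2.
  { apply (cont_rect_sub g x b y d); auto using between_l, between_r. }
  assert (Rabs (m - x) + Rabs (n - y) = s * L) as Elen.
  { unfold m, n, L. replace (x + s * (b - x) - x) with (s * (b - x)) by ring.
    replace (y + s * (d - y) - y) with (s * (d - y)) by ring.
    rewrite !Rabs_mult, (Rabs_pos_eq s) by lra. ring. }
  eapply Rle_trans.
  { apply (rectI_bound g x m y n (1 + Cmod (g p)) Hc2). intros z Hz.
    replace (g z) with ((g z - g p) + g p)%C by ring.
    eapply Rle_trans; [apply Cmod_triangle|]. apply Rplus_le_compat_r. apply Rlt_le.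
    apply Hd2. eapply Rle_lt_trans; [apply (in_rect_dist x m y n); auto; split; apply between_l|].
    lra. }
  rewrite Elen. pose proof (Cmod_ge_0 (g p)).
  replace (2 * (s * L) * (1 + Cmod (g p))) with (s * (2 * L * (1 + Cmod (g p)))) by ring.
  apply Rmult_le_compat_r; [|lra]. apply Rmult_le_pos; lra.
Qed.

(** A single point where the function is only continuous does no harm: the lines through
    it cut the rectangle into rectangles having it as a corner. This is what later
    allows difference quotients, before they are known to be differentiable at their
    centre. *)
Lemma goursat_except g p a b c d :
  cont_rect g a b c d ->
  (forall z, in_rect a b c d z -> z <> p -> exists l, cderiv g z l) ->
  rectI g a b c d = RtoC 0.
Proof.
  intros Hc Hg.
  destruct (excluded_middle_informative (in_rect a b c d p)) as [Hp|Hp].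
  2: { apply goursat. intros z Hz. apply Hg; auto. intros ->. auto. }
  destruct p as [x y]. destruct Hp as [Hx Hy]. simpl in Hx, Hy.
  assert (forall b' d', between a b b' -> between c d d' -> cont_rect g x b' y d') as Hcc.
  { intros b' d' Hb Hd. apply (cont_rect_sub g a b c d); auto. }
  assert (forall b' d', between a b b' -> between c d d' -> rectI g x b' y d' = RtoC 0) as Hcorner.
  { intros b' d' Hb Hd. apply goursat_except_corner; auto.
    intros z [Z1 Z2] Nz. apply Hg; auto. split.
    - apply (between_sub a b x b'); auto.
    - apply (between_sub c d y d'); auto. }
  assert (forall b', between a b b' -> rectI g x b' c d = RtoC 0) as Hside.
  { intros b' Hb. rewrite (rectI_split_v g x b' c y d).
    - rewrite (Hcorner b' d) by auto using between_r.
      rewrite (rectI_swap_v g x b' y c) by auto using between_l.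
      rewrite (Hcorner b' c) by auto using between_l. ring.
    - apply (cont_rect_sub g a b c d); auto using between_l, between_r.
    - auto. }
  rewrite (rectI_split_h g a x b c d) by auto.
  rewrite (Hside b) by auto using between_r.
  rewrite (rectI_swap_h g x a c d).
  - rewrite (Hside a) by auto using between_l. ring.
  - apply (cont_rect_sub g a b c d); auto using between_l, between_r.
Qed.

(** * Primitives on the disc *)

Lemma unit_disc_iff (z : C) : unit_disc z <-> fst z ^ 2 + snd z ^ 2 < 1.
Proof.
  unfold unit_disc, Cmod. split; intros H.
  - pose proof (pow2_ge_0 (fst z)). pose proof (pow2_ge_0 (snd z)).
    rewrite <- (sqrt_sqrt (fst z ^ 2 + snd z ^ 2)) by lra.
    pose proof (sqrt_pos (fst z ^ 2 + snd z ^ 2)). nra.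
  - rewrite <- sqrt_1. apply sqrt_lt_1_alt. split; auto.
    pose proof (pow2_ge_0 (fst z)). pose proof (pow2_ge_0 (snd z)). lra.
Qed.

Lemma between_0_sqr a x : between 0 a x -> x ^ 2 <= a ^ 2.
Proof. unfold between, Rmin, Rmax. destruct (Rle_dec 0 a); nra. Qed.

Lemma between_sqr a b x K : between a b x -> a ^ 2 <= K -> b ^ 2 <= K -> x ^ 2 <= K.
Proof.
  unfold between, Rmin, Rmax. intros H Ha Hb.
  destruct (Rle_dec a b); destruct (Rle_dec 0 x); nra.
Qed.

(** One side of the rectangle lies on the real axis, so none of its points is farther
    from 0 than the farther of the two corners at height [y]. *)
Lemma disc_rect x x' y z : unit_disc (x, y) -> unit_disc (x', y) ->
  in_rect x x' 0 y z -> unit_disc z.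
Proof.
  rewrite !unit_disc_iff. simpl. intros H1 H2 [H3 H4].
  apply between_0_sqr in H4.
  destruct (Rle_dec (x ^ 2) (x' ^ 2)).
  - pose proof (between_sqr x x' (fst z) (x' ^ 2) H3 ltac:(lra) ltac:(lra)). simpl in *; lra.
  - pose proof (between_sqr x x' (fst z) (x ^ 2) H3 ltac:(lra) ltac:(lra)). simpl in *; lra.
Qed.

Lemma Cmod_le_coords (u v u' v' : R) :
  Rabs u <= Rabs u' -> Rabs v <= Rabs v' -> Cmod (u, v) <= Cmod (u', v').
Proof.
  intros H1 H2. unfold Cmod. simpl fst. simpl snd. apply sqrt_le_1_alt.
  apply Rsqr_le_abs_1 in H1. apply Rsqr_le_abs_1 in H2. unfold Rsqr in *. lra.
Qed.

(** The primitive at [(x, y)] is the integral along the real axis from 0 to [x] followed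
    by the vertical segment up to [y]. Because integrals around rectangles vanish, its
    increment is an integral along an L-shaped path from the base point, where [g] is
    within [eps / 2] of its value. *)
Lemma primitive_on_disc g p :
  (forall z, unit_disc z -> ccont g z) ->
  (forall z, unit_disc z -> z <> p -> exists l, cderiv g z l) ->
  exists G, forall z, unit_disc z -> cderiv G z (g z).
Proof.
  intros Hc Hg.
  exists (fun z => CInt (fun s => g (s, 0)) 0 (fst z)
     + Ci * CInt (fun t => g (fst z, t)) 0 (snd z))%C.
  intros [x y] Hz eps He.
  assert (forall x y, unit_disc (x, y) -> pcont_on (fun s => g (s, 0)) 0 x) as Hax.
  { intros x1 y1 H t Ht. apply pcont_hor. apply Hc.
    rewrite unit_disc_iff in *. simpl in *. apply between_0_sqr in Ht.
    pose proof (pow2_ge_0 y1). simpl in *. lra. }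
  assert (forall x y, unit_disc (x, y) -> pcont_on (fun t => g (x, t)) 0 y) as Hay.
  { intros x1 y1 H t Ht. apply pcont_ver. apply Hc.
    rewrite unit_disc_iff in *. simpl in *. apply between_0_sqr in Ht. simpl in *; lra. }
  destruct (Hc _ Hz (eps / 2) ltac:(lra)) as [d1 [Hd1 H1]].
  assert (Cmod (x, y) < 1) as Hz1 by exact Hz.
  exists (Rmin d1 (1 - Cmod (x, y))). split; [apply Rmin_pos; lra|].
  intros [x' y'] Hw.
  pose proof (Rmin_l d1 (1 - Cmod (x, y))). pose proof (Rmin_r d1 (1 - Cmod (x, y))).
  set (D := Cmod ((x', y') - (x, y))%C) in *.
  assert (forall s t, between x x' s -> between y y' t ->
     Cmod ((s, t) - (x, y))%C <= D) as Hnear.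
  { intros s t Hs Ht. unfold D, Cminus, Cplus, Copp. simpl.
    apply Cmod_le_coords.
    - apply (between_dist x x' s x Hs (between_l _ _)).
    - apply (between_dist y y' t y Ht (between_l _ _)). }
  assert (forall s t, between x x' s -> between y y' t -> unit_disc (s, t)) as Hin.
  { intros s t Hs Ht. unfold unit_disc.
    replace (s, t) with (((s, t) - (x, y)) + (x, y))%C by ring.
    eapply Rle_lt_trans; [apply Cmod_triangle|]. specialize (Hnear s t Hs Ht). lra. }
  assert (forall s t, between x x' s -> between y y' t ->
     Cmod (g (s, t) - g (x, y))%C <= eps / 2) as Hosc.
  { intros s t Hs Ht. apply Rlt_le. apply H1. specialize (Hnear s t Hs Ht). lra. }
  assert (unit_disc (x', y)) as Hx'y by (apply Hin; auto using between_l, between_r).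
  assert (unit_disc (x', y')) as Hx'y' by (apply Hin; auto using between_l, between_r).
  assert (rectI g x x' 0 y = RtoC 0) as Hrect.
  { assert (forall w, in_rect x x' 0 y w -> unit_disc w) as Hsub.
    { intros w. apply disc_rect; auto. }
    apply (goursat_except g p); intros w Hin_w; auto. }
  assert (pcont_on (fun s => g (s, y)) x x') as Hc1.
  { intros t Ht. apply pcont_hor, Hc, Hin; auto using between_l. }
  assert (pcont_on (fun t => g (x', t)) y y') as Hc2.
  { intros t Ht. apply pcont_ver, Hc, Hin; auto using between_r. }
  assert (pcont_on (fun s => g (s, 0)) x x') as Hc3.
  { intros t Ht. apply pcont_hor. apply Hc. apply (disc_rect x x' y); auto.
    split; simpl; auto using between_l. }
  simpl fst. simpl snd.
  rewrite (CInt_Chasles (fun s => g (s, 0)) 0 x x') by eauto.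
  rewrite (CInt_Chasles (fun t => g (x', t)) 0 y y') by eauto.
  unfold rectI in Hrect.
  set (A := CInt (fun s => g (s, 0)) 0 x) in *.
  set (B := CInt (fun s => g (s, 0)) x x') in *.
  set (V' := CInt (fun t => g (x', t)) 0 y) in *.
  set (V := CInt (fun t => g (x, t)) 0 y) in *.
  set (H' := CInt (fun s => g (s, y)) x x') in *.
  set (W := CInt (fun t => g (x', t)) y y') in *.
  set (c := g (x, y)) in *.
  assert (H' - RtoC (x' - x) * c = CInt (fun s => g (s, y) + - c)%C x x')%C as E1.
  { rewrite CInt_plus; auto.
    - rewrite CInt_const. unfold H'. ring.
    - intros t _. apply pcont_const. }
  assert (W - RtoC (y' - y) * c = CInt (fun t => g (x', t) + - c)%C y y')%C as E2.
  { rewrite CInt_plus; auto.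
    - rewrite CInt_const. unfold W. ring.
    - intros t _. apply pcont_const. }
  replace (A + B + Ci * (V' + W) - (A + Ci * V) - c * ((x', y') - (x, y)))%C
    with ((H' - RtoC (x' - x) * c) + Ci * (W - RtoC (y' - y) * c))%C.
  2: { replace (((x', y') : C) - (x, y))%C with (RtoC (x' - x) + Ci * RtoC (y' - y))%C.
       - replace B with (H' + Ci * V - Ci * V')%C.
         + ring.
         + replace (H' + Ci * V - Ci * V')%C with (B - (B + Ci * V' - H' - Ci * V))%C by ring.
           rewrite Hrect. ring.
       - unfold RtoC, Ci, Cmult, Cminus, Cplus, Copp. simpl. f_equal; ring. }
  rewrite E1, E2.
  eapply Rle_trans; [apply Cmod_triangle|]. rewrite Cmod_mult, Cmod_Ci, Rmult_1_l.
  assert (Rabs (x' - x) <= D) as Dx by exact (re_le_Cmod ((x', y') - (x, y))%C).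
  assert (Rabs (y' - y) <= D) as Dy by exact (Im_le_Cmod ((x', y') - (x, y))%C).
  assert (Cmod (CInt (fun s => g (s, y) + - c)%C x x') <= Rabs (x' - x) * (eps / 2)).
  { apply CInt_bound.
    - intros t Ht. apply pcont_plus; auto. apply pcont_const.
    - intros t Ht. apply Hosc; auto using between_l. }
  assert (Cmod (CInt (fun t => g (x', t) + - c)%C y y') <= Rabs (y' - y) * (eps / 2)).
  { apply CInt_bound.
    - intros t Ht. apply pcont_plus; auto. apply pcont_const.
    - intros t Ht. apply Hosc; auto using between_r. }
  nra.
Qed.

(** * Cauchy's formula on circles *)

Definition holo (f : C -> C) : Prop := forall z, unit_disc z -> exists l, cderiv f z l.

Lemma holo_iff f : analytic_on_disc f <-> holo f.
Proof. split; intros H z Hz; apply ex_derive_cderiv; apply H; exact Hz. Qed.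

Definition circ (rho t : R) : C := (rho * cos t, rho * sin t).

Lemma Cmod_circ rho t : 0 <= rho -> Cmod (circ rho t) = rho.
Proof.
  intros H. unfold Cmod, circ. simpl fst. simpl snd.
  replace ((rho * cos t) ^ 2 + (rho * sin t) ^ 2) with (rho * rho).
  - apply sqrt_square. exact H.
  - pose proof (sin2_cos2 t) as E. unfold Rsqr in E.
    replace ((rho * cos t) ^ 2 + (rho * sin t) ^ 2)
      with (rho * rho * (sin t * sin t + cos t * cos t)) by ring.
    rewrite E. ring.
Qed.

Lemma circ_neq rho t w : Cmod w < rho -> circ rho t <> w.
Proof.
  intros H E. pose proof (Cmod_ge_0 w).
  pose proof (Cmod_circ rho t ltac:(lra)) as E2. rewrite E in E2. lra.
Qed.

Lemma circ_neq_0 rho t : 0 < rho -> circ rho t <> RtoC 0.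
Proof. intros H. apply circ_neq. rewrite Cmod_0. exact H. Qed.

Lemma pderiv_circ rho t : pderiv (circ rho) t (Ci * circ rho t)%C.
Proof.
  unfold pderiv, circ, Re, Im. simpl.
  split; auto_derive; auto; ring.
Qed.

(** The circle is a closed curve, so any primitive has zero increment around it. *)
Lemma circ_closed rho : circ rho (2 * PI) = circ rho 0.
Proof. unfold circ. rewrite cos_2PI, sin_2PI, cos_0, sin_0. reflexivity. Qed.

Lemma pcont_circ_comp f rho t : ccont f (circ rho t) -> pcont (fun t => f (circ rho t)) t.
Proof.
  intros H. apply (pcont_comp f); auto.
  eapply pderiv_pcont. apply pderiv_circ.
Qed.

Lemma cderiv_pow n z : cderiv (fun x => x ^ (S n))%C z (RtoC (INR (S n)) * z ^ n)%C.
Proof.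
  induction n as [|n IH].
  - simpl. replace (1 * 1)%C with (RtoC 1) by ring.
    apply (cderiv_ext_loc (fun x => x) _ z _ 1); [lra|intros; ring|]. apply cderiv_id.
  - replace (RtoC (INR (S (S n))) * z ^ S n)%C
      with (1 * z ^ S n + z * (RtoC (INR (S n)) * z ^ n))%C.
    + apply (cderiv_mult (fun x => x) (fun x => x ^ S n)%C); auto. apply cderiv_id.
    + rewrite (S_INR (S n)), RtoC_plus. simpl. ring.
Qed.

Lemma ccont_pow n z : ccont (fun x => x ^ n)%C z.
Proof.
  destruct n.
  - apply cderiv_ccont with (RtoC 0). simpl. apply cderiv_const.
  - eapply cderiv_ccont. apply cderiv_pow.
Qed.

Lemma pcont_inv_circ rho w t : Cmod w < rho -> pcont (fun t => / (circ rho t - w))%C t.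
Proof.
  intros H. apply (pcont_circ_comp (fun x => / (x - w))%C).
  eapply cderiv_ccont. apply (cderiv_comp (fun x => / x)%C (fun x => x - w)%C).
  - apply cderiv_inv. intros E. apply (circ_neq rho t w H).
    replace (circ rho t) with ((circ rho t - w) + w)%C by ring. rewrite E. ring.
  - apply cderiv_minus_const.
Qed.

Lemma pcont_pow_comp u n t : pcont u t -> pcont (fun t => (u t) ^ n)%C t.
Proof. intros H. apply (pcont_comp (fun x => x ^ n)%C u); auto. apply ccont_pow. Qed.

Lemma pcont_circ rho t : pcont (circ rho) t.
Proof. eapply pderiv_pcont. apply pderiv_circ. Qed.

Lemma pcont_inv_circ_0 rho t : 0 < rho -> pcont (fun t => / circ rho t)%C t.
Proof.
  intros H. apply (pcont_circ_comp (fun x => / x)%C).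
  eapply cderiv_ccont. apply cderiv_inv. apply circ_neq_0. exact H.
Qed.

(** The difference quotient of [f] centred at [w], with [l] filled in at the centre. *)
Definition dquot (f : C -> C) (w l z : C) : C :=
  if Ceq_dec z w then l else ((f z - f w) / (z - w))%C.

Lemma dquot_eq f w l : dquot f w l w = l.
Proof. unfold dquot. destruct (Ceq_dec w w); congruence. Qed.

Lemma dquot_neq f w l z : z <> w -> dquot f w l z = ((f z - f w) / (z - w))%C.
Proof. intros H. unfold dquot. destruct (Ceq_dec z w); congruence. Qed.

Lemma Cminus_neq_0 (z w : C) : z <> w -> (z - w)%C <> RtoC 0.
Proof.
  intros H E. apply H. replace z with ((z - w) + w)%C by ring. rewrite E. ring.
Qed.

Lemma dquot_cderiv f w l z m : z <> w -> cderiv f z m -> exists m', cderiv (dquot f w l) z m'.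
Proof.
  intros Hz Hf.
  assert (0 < Cmod (z - w)%C) as Hpos by (apply Cmod_gt_0, Cminus_neq_0; auto).
  eexists. apply (cderiv_ext_loc (fun x => (f x + - f w) * / (x - w))%C _ z _ (Cmod (z - w)%C)); auto.
  - intros x Hx. rewrite dquot_neq; [reflexivity|].
    intros ->. rewrite Cmod_minus_sym in Hx. lra.
  - apply (cderiv_mult (fun x => f x + - f w)%C (fun x => / (x - w))%C).
    + apply (cderiv_plus f (fun _ => - f w)%C); [exact Hf|apply cderiv_const].
    + apply (cderiv_comp (fun x => / x)%C (fun x => x - w)%C).
      * apply cderiv_inv. apply Cminus_neq_0. exact Hz.
      * apply cderiv_minus_const.
Qed.

Lemma dquot_ccont f w l : cderiv f w l -> ccont (dquot f w l) w.
Proof.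
  intros Hf eps He. destruct (Hf (eps / 2) ltac:(lra)) as [d [Hd H]].
  exists d. split; auto. intros z Hz. rewrite dquot_eq.
  destruct (Ceq_dec z w) as [->|Hn].
  - rewrite dquot_eq, Cmod_self_minus. exact He.
  - rewrite dquot_neq by auto. specialize (H z Hz).
    pose proof (Cminus_neq_0 z w Hn) as Hn'.
    assert (0 < Cmod (z - w)%C) as Hp by (apply Cmod_gt_0; auto).
    replace ((f z - f w) / (z - w) - l)%C
      with ((f z - f w - l * (z - w)) / (z - w))%C by (field; auto).
    rewrite Cmod_div by auto.
    apply Rle_lt_trans with (eps / 2); [|lra].
    apply Rmult_le_reg_r with (Cmod (z - w)%C); auto.
    unfold Rdiv at 1. rewrite Rmult_assoc, Rinv_l, Rmult_1_r by lra. exact H.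
Qed.

(** The difference quotient is continuous, and differentiable off [w], so it has a
    primitive on the disc and its contour integral vanishes. In the parameter of the
    circle, [dz] is [Ci * z dt], hence the factor [circ rho t]. *)
Lemma dquot_circle_integral f w rho : holo f -> Cmod w < rho < 1 ->
  CInt (fun t => circ rho t * ((f (circ rho t) - f w) * / (circ rho t - w)))%C 0 (2 * PI) = RtoC 0.
Proof.
  intros Hf [Hw Hr].
  assert (unit_disc w) as Hwd by (unfold unit_disc; lra).
  destruct (Hf w Hwd) as [l Hl].
  pose proof (Cmod_ge_0 w) as Hw0.
  destruct (primitive_on_disc (dquot f w l) w) as [G HG].
  - intros z Hz. destruct (Ceq_dec z w) as [->|Hn].
    + apply dquot_ccont. exact Hl.
    + destruct (Hf z Hz) as [m Hm]. destruct (dquot_cderiv f w l z m Hn Hm) as [m' Hm'].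
      eapply cderiv_ccont; eauto.
  - intros z Hz Hn. destruct (Hf z Hz) as [m Hm]. apply (dquot_cderiv f w l z m Hn Hm).
  - assert (forall t, unit_disc (circ rho t)) as Hin.
    { intros t. unfold unit_disc. rewrite Cmod_circ; lra. }
    set (q := fun t => (dquot f w l (circ rho t) * (Ci * circ rho t))%C).
    assert (CInt q 0 (2 * PI) = RtoC 0) as Hq.
    { rewrite (CInt_FTC (fun t => G (circ rho t))).
      - cbv beta. rewrite circ_closed. ring.
      - intros t _. apply pderiv_comp; [apply HG, Hin|apply pderiv_circ].
      - intros t _. apply pcont_mult.
        + apply pcont_circ_comp. destruct (Hf _ (Hin t)) as [m Hm].
          destruct (dquot_cderiv f w l (circ rho t) m (circ_neq _ _ _ Hw) Hm) as [m' Hm'].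
          eapply cderiv_ccont; eauto.
        + apply pcont_mult; [apply pcont_const|apply pcont_circ]. }
    rewrite (CInt_ext _ (fun t => (- Ci) * q t)%C).
    + rewrite CInt_scal, Hq; [ring|].
      intros t _. apply pcont_mult.
      * apply pcont_circ_comp. destruct (Hf _ (Hin t)) as [m Hm].
        destruct (dquot_cderiv f w l (circ rho t) m (circ_neq _ _ _ Hw) Hm) as [m' Hm'].
        eapply cderiv_ccont; eauto.
      * apply pcont_mult; [apply pcont_const|apply pcont_circ].
    + intros t _. unfold q. rewrite dquot_neq by (apply circ_neq; auto).
      assert (Ci * Ci = - (1))%C as Ei.
      { unfold Ci, RtoC, Cmult, Copp. simpl. f_equal; ring. }
      set (z := circ rho t). set (v := (f z - f w)%C). unfold Cdiv.
      transitivity (- (Ci * Ci) * (z * (v * / (z - w))))%C; [rewrite Ei; ring|ring].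
Qed.

(** With [z = circ rho t], the weight [(w / z)^n * z / (z - w)] is the sum of the terms
    of order at least [n] of the geometric series of [z / (z - w)] in [w / z]. For
    [n = 0] this is Cauchy's integral, and for larger [n] the remainder of the Taylor
    expansion, so that no series has to be integrated term by term. *)
Definition tail_integral (F : R -> C) (rho : R) (w : C) (n : nat) : C :=
  CInt (fun t => F t * ((w * / circ rho t) ^ n * (circ rho t * / (circ rho t - w))))%C 0 (2 * PI).

Definition moment (F : R -> C) (rho : R) (n : nat) : C :=
  CInt (fun t => F t * (/ circ rho t) ^ n)%C 0 (2 * PI).

Lemma tail_integral_pcont F rho w n : Cmod w < rho -> pcont_on F 0 (2 * PI) ->
  pcont_on (fun t => F t * ((w * / circ rho t) ^ n * (circ rho t * / (circ rho t - w))))%C 0 (2 * PI).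
Proof.
  intros Hw HF t Ht. pose proof (Cmod_ge_0 w).
  apply pcont_mult; auto. apply pcont_mult.
  - apply pcont_pow_comp. apply pcont_mult; [apply pcont_const|apply pcont_inv_circ_0; lra].
  - apply pcont_mult; [apply pcont_circ|apply pcont_inv_circ; auto].
Qed.

Lemma moment_pcont F rho n : 0 < rho -> pcont_on F 0 (2 * PI) ->
  pcont_on (fun t => F t * (/ circ rho t) ^ n)%C 0 (2 * PI).
Proof.
  intros Hr HF t Ht. apply pcont_mult; auto. apply pcont_pow_comp, pcont_inv_circ_0; auto.
Qed.

Lemma tail_integral_step F rho w n : Cmod w < rho -> pcont_on F 0 (2 * PI) ->
  tail_integral F rho w n = (w ^ n * moment F rho n + tail_integral F rho w (S n))%C.
Proof.
  intros Hw HF. pose proof (Cmod_ge_0 w). unfold moment.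
  rewrite <- CInt_scal by (apply moment_pcont; auto; lra).
  unfold tail_integral. rewrite <- CInt_plus.
  - apply CInt_ext. intros t _.
    pose proof (circ_neq_0 rho t ltac:(lra)) as N1.
    pose proof (Cminus_neq_0 _ _ (circ_neq rho t w Hw)) as N2.
    set (z := circ rho t) in *. rewrite Cpow_S, Cpow_mult_l.
    set (wn := (w ^ n)%C). set (zn := ((/ z) ^ n)%C). field; auto.
  - intros t Ht. apply pcont_mult; [apply pcont_const|apply moment_pcont; auto; lra].
  - apply tail_integral_pcont; auto.
Qed.

(** On the circle |w / z| = |w| / rho and |z - w| >= rho - |w|. *)
Lemma tail_integral_bound F rho w n M : Cmod w < rho -> pcont_on F 0 (2 * PI) ->
  (forall t, between 0 (2 * PI) t -> Cmod (F t) <= M) ->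
  Cmod (tail_integral F rho w n) * (rho - Cmod w) <= 2 * PI * M * rho * (Cmod w / rho) ^ n.
Proof.
  intros Hw HF HM. pose proof (Cmod_ge_0 w) as Hw0. pose proof PI_RGT_0.
  assert (0 <= M) by (eapply Rle_trans; [apply Cmod_ge_0|apply (HM 0), between_l]).
  set (r := Cmod w) in *.
  assert (0 <= (r / rho) ^ n).
  { apply pow_le. apply Rdiv_le_0_compat; lra. }
  assert (Cmod (tail_integral F rho w n)
     <= Rabs (2 * PI - 0) * (M * ((r / rho) ^ n * (rho * / (rho - r))))) as Hb.
  { apply CInt_bound; [apply tail_integral_pcont; auto|]. intros t Ht.
    pose proof (circ_neq_0 rho t ltac:(lra)) as N1.
    pose proof (Cminus_neq_0 _ _ (circ_neq rho t w Hw)) as N2.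
    rewrite !Cmod_mult, Cmod_pow, Cmod_mult, !Cmod_inv by auto.
    rewrite Cmod_circ by lra. fold r. fold (r / rho).
    apply Rmult_le_compat; auto using Cmod_ge_0.
    - apply Rmult_le_pos; auto. apply Rmult_le_pos; [lra|].
      apply Rlt_le, Rinv_0_lt_compat, Cmod_gt_0; auto.
    - apply Rmult_le_compat_l; auto. apply Rmult_le_compat_l; [lra|].
      apply Rinv_le_contravar; [lra|].
      pose proof (Cmod_triangle_inv (circ rho t) w) as HT.
      rewrite Cmod_circ in HT by lra. exact HT. }
  rewrite Rminus_0_r, (Rabs_pos_eq (2 * PI)) in Hb by lra.
  apply Rmult_le_compat_r with (r := rho - r) in Hb; [|lra].
  eapply Rle_trans; [exact Hb|]. apply Req_le. field. lra.
Qed.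

(** For a positive exponent, [z^-n] is, up to a constant factor, its own derivative along
    the circle. *)
Lemma moment_of_1 rho n : 0 < rho -> moment (fun _ => RtoC 1) rho (S n) = RtoC 0.
Proof.
  intros Hr. unfold moment.
  set (c := (- (RtoC (INR (S n)) * Ci))%C).
  assert (pcont_on (fun t => (/ circ rho t) ^ S n)%C 0 (2 * PI)) as Hc.
  { intros t _. apply pcont_pow_comp, pcont_inv_circ_0; auto. }
  assert (CInt (fun t => c * (/ circ rho t) ^ S n)%C 0 (2 * PI) = RtoC 0) as E.
  { rewrite (CInt_FTC (fun t => (/ circ rho t) ^ S n)%C).
    - cbv beta. rewrite circ_closed. ring.
    - intros t _.
      pose proof (circ_neq_0 rho t ltac:(lra)) as N1.
      pose proof (pderiv_comp (fun x => (/ x) ^ S n)%C (circ rho) t _ _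
        (cderiv_comp (fun x => x ^ S n)%C (fun x => / x)%C _ _ _
          (cderiv_pow n _) (cderiv_inv _ N1)) (pderiv_circ rho t)) as H.
      cbv beta in H.
      replace (c * (/ circ rho t) ^ S n)%C with
        (RtoC (INR (S n)) * (/ circ rho t) ^ n * - / (circ rho t * circ rho t) *
           (Ci * circ rho t))%C; [exact H|].
      unfold c. rewrite Cpow_S. set (q := ((/ circ rho t) ^ n)%C). field; auto.
    - intros t Ht. apply pcont_mult; [apply pcont_const|apply Hc; auto]. }
  rewrite CInt_scal in E by exact Hc.
  rewrite (CInt_ext _ (fun t => (/ circ rho t) ^ S n)%C) by (intros; ring).
  apply NNPP. intros N. revert E. apply Cmult_neq_0; auto.
  apply Cmod_gt_0. unfold c. rewrite Cmod_opp, Cmod_mult, Cmod_Ci, Cmod_R.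
  pose proof (lt_0_INR (S n) ltac:(lia)). rewrite Rabs_pos_eq; lra.
Qed.

Lemma moment_0 F rho : moment F rho 0 = CInt F 0 (2 * PI).
Proof. unfold moment. apply CInt_ext. intros. simpl. ring. Qed.

Lemma pow_lt_eps q K eps : 0 <= q < 1 -> 0 < eps -> exists N, forall n, (N <= n)%nat -> K * q ^ n < eps.
Proof.
  intros Hq He.
  destruct (pow_lt_1_zero q ltac:(rewrite Rabs_pos_eq; lra) (eps / (1 + Rabs K))) as [N HN].
  { apply Rdiv_lt_0_compat; [lra|]. pose proof (Rabs_pos K). lra. }
  exists N. intros n Hn. specialize (HN n Hn).
  assert (0 <= q ^ n) by (apply pow_le; lra).
  rewrite Rabs_pos_eq in HN by auto.
  pose proof (Rabs_pos K). pose proof (Rle_abs K).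
  apply Rmult_lt_compat_l with (r := 1 + Rabs K) in HN; [|lra].
  replace ((1 + Rabs K) * (eps / (1 + Rabs K))) with eps in HN by (field; lra).
  nra.
Qed.

Lemma div_pow_bounds r rho : 0 <= r < rho -> 0 <= r / rho < 1.
Proof.
  intros H. split.
  - apply Rdiv_le_0_compat; lra.
  - apply Rmult_lt_reg_r with rho; [lra|]. unfold Rdiv. rewrite Rmult_assoc, Rinv_l; lra.
Qed.

(** All the tails of order at least 1 are equal because the intermediate moments vanish,
    and they tend to 0; only the constant term of the geometric series is left. *)
Lemma tail_integral_of_1 rho w : Cmod w < rho ->
  tail_integral (fun _ => RtoC 1) rho w 0 = RtoC (2 * PI).
Proof.
  intros Hw. pose proof (Cmod_ge_0 w). pose proof PI_RGT_0.
  assert (pcont_on (fun _ : R => RtoC 1) 0 (2 * PI)) as Hc by (intros t _; apply pcont_const).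
  assert (forall n, tail_integral (fun _ => RtoC 1) rho w (S n)
     = tail_integral (fun _ => RtoC 1) rho w 1) as E.
  { induction n; auto. rewrite <- IHn, (tail_integral_step _ rho w (S n)), moment_of_1 by (auto; lra). ring. }
  assert (tail_integral (fun _ => RtoC 1) rho w 1 = RtoC 0) as E0.
  { apply Cmod_eq_0. apply Rle_antisym; [|apply Cmod_ge_0]. apply Rnot_lt_le. intros Hp.
    destruct (pow_lt_eps (Cmod w / rho) (2 * PI * 1 * rho)
      (Cmod (tail_integral (fun _ => RtoC 1) rho w 1) * (rho - Cmod w))) as [N HN].
    - apply div_pow_bounds. lra.
    - apply Rmult_lt_0_compat; lra.
    - specialize (HN (S N) ltac:(lia)). rewrite <- (E N) in HN.
      pose proof (tail_integral_bound (fun _ => RtoC 1) rho w (S N) 1 Hw Hc) as HB.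
      specialize (HB ltac:(intros; cbv beta; rewrite Cmod_1; lra)). lra. }
  rewrite tail_integral_step, E0, moment_0, CInt_const by auto. simpl.
  rewrite Rminus_0_r. ring.
Qed.

(** Splitting the vanishing integral of the difference quotient into the part with
    [f (circ rho t)] and the part with the constant [f w]. *)
Lemma cauchy_formula f w rho : holo f -> Cmod w < rho < 1 ->
  tail_integral (fun t => f (circ rho t)) rho w 0 = (RtoC (2 * PI) * f w)%C.
Proof.
  intros Hf [Hw Hr]. pose proof (Cmod_ge_0 w).
  assert (pcont_on (fun t => f (circ rho t)) 0 (2 * PI)) as HF.
  { intros t _. apply pcont_circ_comp.
    destruct (Hf (circ rho t)) as [m Hm]; [unfold unit_disc; rewrite Cmod_circ; lra|].
    eapply cderiv_ccont; eauto. }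
  pose proof (dquot_circle_integral f w rho Hf (conj Hw Hr)) as E.
  assert (pcont_on (fun _ : R => RtoC 1) 0 (2 * PI)) as Hc by (intros t _; apply pcont_const).
  pose proof (tail_integral_pcont _ rho w 0 Hw HF) as P1.
  pose proof (tail_integral_pcont _ rho w 0 Hw Hc) as P2.
  rewrite <- (tail_integral_of_1 rho w Hw).
  assert (tail_integral (fun t => f (circ rho t)) rho w 0
     + (- f w) * tail_integral (fun _ => RtoC 1) rho w 0 = 0)%C as E2.
  { unfold tail_integral. rewrite <- CInt_scal by exact P2. rewrite <- CInt_plus; auto.
    - rewrite <- E. apply CInt_ext. intros t _. simpl. ring.
    - intros t Ht. apply pcont_mult; [apply pcont_const|apply P2; auto]. }
  replace (tail_integral (fun t => f (circ rho t)) rho w 0) with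
    ((tail_integral (fun t => f (circ rho t)) rho w 0 +
      - f w * tail_integral (fun _ : R => 1) rho w 0)
      + f w * tail_integral (fun _ : R => 1) rho w 0)%C by ring.
  rewrite E2. ring.
Qed.

(** * Taylor expansions *)

Fixpoint csum (a : nat -> C) (n : nat) : C :=
  match n with O => RtoC 0 | S n => (csum a n + a n)%C end.

Definition taylor_rem (f : C -> C) (a : nat -> C) (w : C) (n : nat) : C :=
  (f w - csum (fun k => a k * w ^ k) n)%C.

(** The coefficients depend on the radius at this stage. The case [n = 0] bounds [f w] by
    the maximum of |f| on the circle, up to the factor rho / (rho - |w|). *)
Lemma cauchy_taylor f rho : holo f -> 0 < rho < 1 ->
  exists a, forall M,
    (forall t, between 0 (2 * PI) t -> Cmod (f (circ rho t)) <= M) ->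
    forall w n, Cmod w < rho ->
      Cmod (taylor_rem f a w n) * (rho - Cmod w) <= M * rho * (Cmod w / rho) ^ n.
Proof.
  intros Hf Hr. pose proof PI_RGT_0.
  set (F := fun t => f (circ rho t)).
  assert (pcont_on F 0 (2 * PI)) as HF.
  { intros t _. apply pcont_circ_comp.
    destruct (Hf (circ rho t)) as [m Hm]; [unfold unit_disc; rewrite Cmod_circ; lra|].
    eapply cderiv_ccont; eauto. }
  assert (RtoC (2 * PI) <> RtoC 0) as N2 by (intros E; apply RtoC_inj in E; lra).
  exists (fun n => / RtoC (2 * PI) * moment F rho n)%C.
  intros M HM w n Hw.
  assert (RtoC (2 * PI) * taylor_rem f (fun n => / RtoC (2 * PI) * moment F rho n)%C w n
    = tail_integral F rho w n)%C as E.
  { induction n as [|n IH].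
    - unfold F. rewrite cauchy_formula by (auto; lra).
      unfold taylor_rem. simpl. ring.
    - rewrite (tail_integral_step F rho w n Hw HF) in IH.
      unfold taylor_rem in *. simpl.
      replace (tail_integral F rho w (S n)) with
        ((w ^ n * moment F rho n + tail_integral F rho w (S n)) - w ^ n * moment F rho n)%C by ring.
      rewrite <- IH. field. exact N2. }
  pose proof (tail_integral_bound F rho w n M Hw HF HM) as HB.
  rewrite <- E, Cmod_mult, Cmod_R, Rabs_pos_eq in HB by lra.
  apply Rmult_le_reg_l with (2 * PI); [lra|]. lra.
Qed.

(** An expansion to all orders at 0. It mentions no radius and determines the
    coefficients, which identifies the expansions obtained on circles of different
    radii. *)
Definition is_taylor (f : C -> C) (a : nat -> C) : Prop :=
  forall n, exists K d, 0 < d /\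
    forall w, Cmod w < d -> Cmod (taylor_rem f a w n) <= K * Cmod w ^ n.

(** If the coefficients agree below [n], the difference of the two expansions of order
    [n + 1] shows that |a n - b n| |w|^n = O(|w|^(n + 1)). *)
Lemma is_taylor_unique f a b : is_taylor f a -> is_taylor f b -> forall n, a n = b n.
Proof.
  intros Ha Hb n. induction n as [n IH] using (well_founded_induction Wf_nat.lt_wf).
  assert (forall w, csum (fun k => a k * w ^ k)%C n = csum (fun k => b k * w ^ k)%C n) as E.
  { intros w. clear Ha Hb. induction n as [|n IHn]; auto. simpl.
    rewrite IHn by (intros; apply IH; lia). rewrite (IH n) by lia. reflexivity. }
  destruct (Ha (S n)) as (K & d & Hd & H). destruct (Hb (S n)) as (K' & d' & Hd' & H').
  replace (a n) with ((a n - b n) + b n)%C by ring.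
  assert (a n - b n = 0)%C as ->; [|ring].
  apply Cmod_eq_0. apply Rle_antisym; [|apply Cmod_ge_0].
  apply (nonpos_of_le_eps_mult _ (Rabs K + Rabs K')). intros eps He.
  set (t := Rmin eps (Rmin (d / 2) (d' / 2))).
  assert (0 < t <= eps /\ t <= d / 2 /\ t <= d' / 2) as (H1 & H2 & H3).
  { assert (t <= eps) by apply Rmin_l.
    assert (t <= Rmin (d / 2) (d' / 2)) by apply Rmin_r.
    pose proof (Rmin_l (d / 2) (d' / 2)). pose proof (Rmin_r (d / 2) (d' / 2)).
    repeat split; try lra. unfold t. repeat apply Rmin_pos; lra. }
  assert (Cmod (RtoC t) = t) as Et by (rewrite Cmod_R, Rabs_pos_eq; lra).
  specialize (H (RtoC t) ltac:(lra)). specialize (H' (RtoC t) ltac:(lra)).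
  assert (0 < t ^ n) by (apply pow_lt; lra).
  apply Rmult_le_reg_r with (t ^ n); auto.
  assert (Cmod (a n - b n)%C * t ^ n =
    Cmod (taylor_rem f b (RtoC t) (S n) - taylor_rem f a (RtoC t) (S n))%C) as ->.
  { rewrite <- Et at 1. rewrite <- Cmod_pow, <- Cmod_mult. f_equal.
    unfold taylor_rem. simpl. rewrite E. ring. }
  eapply Rle_trans; [apply Cmod_triangle_minus|].
  rewrite Et in H, H'. simpl in H, H'.
  pose proof (Rle_abs K). pose proof (Rle_abs K').
  pose proof (Rabs_pos K). pose proof (Rabs_pos K').
  assert (0 <= t * t ^ n) by nra.
  assert (K * (t * t ^ n) <= Rabs K * (t * t ^ n)) by (apply Rmult_le_compat_r; auto).
  assert (K' * (t * t ^ n) <= Rabs K' * (t * t ^ n)) by (apply Rmult_le_compat_r; auto).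
  apply Rle_trans with ((Rabs K + Rabs K') * (t * t ^ n)); [lra|].
  replace (eps * (Rabs K + Rabs K') * t ^ n) with ((Rabs K + Rabs K') * (eps * t ^ n)) by ring.
  apply Rmult_le_compat_l; [lra|]. apply Rmult_le_compat_r; lra.
Qed.

Lemma circle_bounded f rho : holo f -> 0 < rho < 1 ->
  exists M, forall t, between 0 (2 * PI) t -> Cmod (f (circ rho t)) <= M.
Proof.
  intros Hf Hr. apply (CInt_bounded (fun t => f (circ rho t))).
  intros t _. apply pcont_circ_comp.
  destruct (Hf (circ rho t)) as [m Hm]; [unfold unit_disc; rewrite Cmod_circ; lra|].
  eapply cderiv_ccont; eauto.
Qed.

Lemma taylor_at_radius f rho : holo f -> 0 < rho < 1 ->
  exists a, is_taylor f a /\ exists K, forall w n, Cmod w < rho ->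
      Cmod (taylor_rem f a w n) * (rho - Cmod w) <= K * (Cmod w / rho) ^ n.
Proof.
  intros Hf Hr. destruct (cauchy_taylor f rho Hf Hr) as [a Ha].
  destruct (circle_bounded f rho Hf Hr) as [M HM]. specialize (Ha M HM).
  exists a. split.
  - intros n. exists (2 * M / rho ^ n), (rho / 2). split; [lra|]. intros w Hw.
    specialize (Ha w n ltac:(lra)).
    assert (0 < rho ^ n) by (apply pow_lt; lra).
    apply Rmult_le_reg_r with (rho / 2); [lra|].
    apply Rle_trans with (Cmod (taylor_rem f a w n) * (rho - Cmod w)).
    + apply Rmult_le_compat_l; [apply Cmod_ge_0|lra].
    + eapply Rle_trans; [exact Ha|]. unfold Rdiv at 1.
      rewrite Rpow_mult_distr, pow_inv. apply Req_le. field. lra.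
  - exists (M * rho). exact Ha.
Qed.

Lemma csum_ext a b n : (forall k, a k = b k) -> csum a n = csum b n.
Proof. intros E. induction n; simpl; congruence. Qed.

(** A circle of radius strictly between |w| and 1 gives convergence at [w], and its
    coefficients are those of the fixed radius 1 / 2 by uniqueness. *)
Lemma holo_taylor f : holo f ->
  exists a, is_taylor f a /\
    forall w, unit_disc w -> forall eps, 0 < eps -> exists N, forall n, (N <= n)%nat ->
      Cmod (taylor_rem f a w n) < eps.
Proof.
  intros Hf. destruct (taylor_at_radius f (1 / 2) Hf ltac:(lra)) as [a [Ha _]].
  exists a. split; auto. intros w Hw eps He. unfold unit_disc in Hw.
  pose proof (Cmod_ge_0 w).
  set (rho := (1 + Cmod w) / 2).
  assert (Cmod w < rho < 1) as Hr by (unfold rho; lra).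
  destruct (taylor_at_radius f rho Hf ltac:(lra)) as [b [Hb [K HK]]].
  pose proof (is_taylor_unique f a b Ha Hb) as E.
  destruct (pow_lt_eps (Cmod w / rho) K (eps * (rho - Cmod w))) as [N HN].
  - apply div_pow_bounds. lra.
  - apply Rmult_lt_0_compat; lra.
  - exists N. intros n Hn. specialize (HN n Hn). specialize (HK w n ltac:(lra)).
    assert (taylor_rem f a w n = taylor_rem f b w n) as ->.
    { unfold taylor_rem. f_equal. apply csum_ext. intros k. rewrite E. reflexivity. }
    apply Rmult_lt_reg_r with (rho - Cmod w); lra.
Qed.

Lemma is_taylor_0 f a : is_taylor f a -> a 0%nat = f (RtoC 0).
Proof.
  intros H. destruct (H 1%nat) as (K & d & Hd & H1).
  specialize (H1 (RtoC 0)). rewrite Cmod_0 in H1. specialize (H1 Hd).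
  unfold taylor_rem in H1. simpl in H1. rewrite Rmult_0_l, Rmult_0_r in H1.
  assert (f 0 - (0 + a 0%nat * 1) = 0)%C as E.
  { apply Cmod_eq_0. apply Rle_antisym; auto. apply Cmod_ge_0. }
  replace (a 0%nat) with (f 0 - (f 0 - (0 + a 0%nat * 1)))%C by ring. rewrite E. ring.
Qed.

Lemma cderiv_of_quadratic f l K d : 0 < d ->
  (forall w, Cmod w < d -> Cmod (f w - f (RtoC 0) - l * w)%C <= K * Cmod w ^ 2) ->
  cderiv f (RtoC 0) l.
Proof.
  intros Hd H eps He.
  set (k := 1 + Rabs K). assert (0 < k) by (unfold k; pose proof (Rabs_pos K); lra).
  exists (Rmin d (eps / k)). split.
  { apply Rmin_pos; auto. apply Rdiv_lt_0_compat; lra. }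
  intros w Hw. pose proof (Rmin_l d (eps / k)). pose proof (Rmin_r d (eps / k)).
  replace (w - 0)%C with w in * by ring.
  eapply Rle_trans; [apply H; lra|].
  pose proof (Cmod_ge_0 w). pose proof (Rle_abs K).
  apply Rle_trans with ((k * Cmod w) * Cmod w); [unfold k; nra|].
  apply Rmult_le_compat_r; auto.
  apply Rle_trans with (k * (eps / k)); [apply Rmult_le_compat_l; lra|].
  apply Req_le. field. lra.
Qed.

Lemma is_taylor_1 f a : is_taylor f a -> cderiv f (RtoC 0) (a 1%nat).
Proof.
  intros Ha. pose proof (is_taylor_0 f a Ha) as E0.
  destruct (Ha 2%nat) as (K & d & Hd & H1).
  apply (cderiv_of_quadratic f _ K d Hd). intros w Hw.
  replace (f w - f 0 - a 1%nat * w)%C with (taylor_rem f a w 2); auto.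
  unfold taylor_rem. simpl. rewrite E0. ring.
Qed.

(** A zero at the origin can be divided out: off 0 the quotient is clearly differentiable,
    and at 0 the expansion of [f] to order 3 gives an expansion of [f z / z] to order
    2. *)
Lemma holo_quotient f : holo f -> f (RtoC 0) = RtoC 0 ->
  exists q, holo q /\ forall z, unit_disc z -> f z = (z * q z)%C.
Proof.
  intros Hf H0. destruct (holo_taylor f Hf) as [a [Ha _]].
  pose proof (is_taylor_0 f a Ha) as E0. rewrite H0 in E0.
  exists (dquot f (RtoC 0) (a 1%nat)). split.
  - intros z Hz. destruct (Ceq_dec z (RtoC 0)) as [->|Hn].
    + exists (a 2%nat). destruct (Ha 3%nat) as (K & d & Hd & H1).
      apply (cderiv_of_quadratic _ _ K d Hd). intros w Hw. rewrite dquot_eq.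
      destruct (Ceq_dec w (RtoC 0)) as [->|Hn].
      * rewrite dquot_eq. replace (a 1%nat - a 1%nat - a 2%nat * 0)%C with (RtoC 0) by ring.
        rewrite Cmod_0. simpl. lra.
      * rewrite dquot_neq by auto. specialize (H1 w Hw).
        assert (0 < Cmod w) by (apply Cmod_gt_0; auto).
        apply Rmult_le_reg_r with (Cmod w); auto. rewrite <- Cmod_mult.
        replace (((f w - f 0) / (w - 0) - a 1%nat - a 2%nat * w) * w)%C with (taylor_rem f a w 3).
        { eapply Rle_trans; [exact H1|]. apply Req_le. ring. }
        unfold taylor_rem. simpl. rewrite E0, H0. field.
        replace (w - 0)%C with w by ring. exact Hn.
    + destruct (Hf z Hz) as [m Hm]. apply (dquot_cderiv f _ _ z m Hn Hm).
  - intros z Hz. destruct (Ceq_dec z (RtoC 0)) as [->|Hn].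
    + rewrite H0. ring.
    + rewrite dquot_neq by auto. rewrite H0. field.
      replace (z - 0)%C with z by ring. exact Hn.
Qed.

(** * The maximum principle and Schwarz's lemma *)

Lemma pow_bounded_le_1 x K : 0 <= x -> (forall n, x ^ n <= K) -> x <= 1.
Proof.
  intros Hx H. apply Rnot_lt_le. intros Hlt.
  destruct (Pow_x_infinity x) with (b := K + 1) as [N HN].
  - rewrite Rabs_pos_eq; lra.
  - specialize (HN N (le_n _)). specialize (H N).
    rewrite Rabs_pos_eq in HN by (apply pow_le; lra). lra.
Qed.

Lemma holo_pow q n : holo q -> holo (fun z => q z ^ n)%C.
Proof.
  intros Hq z Hz. destruct (Hq z Hz) as [l Hl]. destruct n.
  - exists (RtoC 0). simpl. apply cderiv_const.
  - eexists. apply (cderiv_comp (fun x => x ^ S n)%C q); [apply cderiv_pow|exact Hl].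
Qed.

(** Cauchy's bound for the power [q^n] reads |q z|^n <= M^n * rho / (rho - |z|), where the
    last factor does not depend on [n]; taking [n] large removes it. *)
Lemma max_modulus_circle q rho M z : holo q -> Cmod z < rho < 1 -> 0 < M ->
  (forall t, Cmod (q (circ rho t)) <= M) -> Cmod (q z) <= M.
Proof.
  intros Hq [Hz Hr] HM H. pose proof (Cmod_ge_0 z).
  assert (Cmod (q z) / M <= 1) as H1.
  { apply (pow_bounded_le_1 _ (rho / (rho - Cmod z))).
    - apply Rdiv_le_0_compat; auto. apply Cmod_ge_0.
    - intros n.
      destruct (cauchy_taylor (fun z => q z ^ n)%C rho (holo_pow q n Hq) ltac:(lra)) as [a Ha].
      specialize (Ha (M ^ n)). specialize (Ha ltac:(intros t _; rewrite Cmod_pow;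
        apply pow_incr; split; [apply Cmod_ge_0|apply H]) z 0%nat Hz).
      unfold taylor_rem in Ha. simpl in Ha. replace (q z ^ n - 0)%C with (q z ^ n)%C in Ha by ring.
      rewrite Cmod_pow, Rmult_1_r in Ha.
      assert (0 < M ^ n) by (apply pow_lt; auto).
      unfold Rdiv at 1. rewrite Rpow_mult_distr, pow_inv.
      apply Rmult_le_reg_r with (M ^ n * (rho - Cmod z)); [apply Rmult_lt_0_compat; lra|].
      eapply Rle_trans; [|eapply Rle_trans; [exact Ha|]]; apply Req_le; field; lra. }
  apply Rmult_le_compat_r with (r := M) in H1; [|lra].
  unfold Rdiv in H1. rewrite Rmult_assoc, Rinv_l in H1; lra.
Qed.

(** Write om z = z q z. On the circle of radius [rho] the modulus of [q] is at most
    1 / rho, hence also inside, and [rho] may tend to 1. *)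
Lemma schwarz_lemma om : holo om -> (forall z, unit_disc z -> unit_disc (om z)) ->
  om (RtoC 0) = RtoC 0 -> forall z, unit_disc z -> Cmod (om z) <= Cmod z.
Proof.
  intros Ho Hd H0 z Hz. destruct (holo_quotient om Ho H0) as [q [Hq Eq]].
  pose proof (Hd z Hz) as Hoz. unfold unit_disc in Hz, Hoz.
  pose proof (Cmod_ge_0 z) as Hz0.
  apply Rnot_lt_le. intros Hlt.
  assert (0 < Cmod (om z)) by lra.
  assert (forall rho, Cmod z < rho < 1 -> Cmod (om z) * rho <= Cmod z) as Hrho.
  { intros rho Hr.
    assert (Cmod (q z) <= / rho) as Hqz.
    { apply (max_modulus_circle q rho); auto.
      - apply Rinv_0_lt_compat; lra.
      - intros t.
        assert (unit_disc (circ rho t)) as Hc by (unfold unit_disc; rewrite Cmod_circ; lra).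
        pose proof (Hd _ Hc) as H1. rewrite (Eq _ Hc) in H1. unfold unit_disc in H1.
        rewrite Cmod_mult, Cmod_circ in H1 by lra.
        apply Rmult_le_reg_l with rho; [lra|]. rewrite Rinv_r by lra. lra. }
    rewrite Eq by exact Hz. rewrite Cmod_mult.
    apply Rmult_le_compat_l with (r := Cmod z * rho) in Hqz; [|nra].
    replace (Cmod z * rho * / rho) with (Cmod z) in Hqz by (field; lra). lra. }
  (* if the claim failed, m < 1 and any radius above m, such as (1 + m) / 2, gives a
     contradiction *)
  set (m := Cmod z / Cmod (om z)).
  assert (m * Cmod (om z) = Cmod z) as Em by (unfold m; field; lra).
  assert (m < 1).
  { apply Rmult_lt_reg_r with (Cmod (om z)); lra. }
  assert (Cmod z <= m).
  { apply Rmult_le_reg_r with (Cmod (om z)); auto. rewrite Em. nra. }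
  specialize (Hrho ((1 + m) / 2) ltac:(lra)). nra.
Qed.

(** * Normalized power series *)

Lemma csum_sum_n a n : sum_n (G := C_NormedModule) a n = csum a (S n).
Proof.
  induction n.
  - rewrite sum_O. symmetry. apply Cplus_0_l.
  - rewrite sum_Sn, IHn. reflexivity.
Qed.

Lemma is_series_of_eps a s :
  (forall eps, 0 < eps -> exists N, forall n, (N <= n)%nat -> Cmod (csum a n - s)%C < eps) ->
  is_series (K := C_AbsRing) (V := C_NormedModule) a s.
Proof.
  intros H. apply filterlim_locally. intros eps.
  destruct (H eps (cond_pos eps)) as [N HN]. exists N. intros n Hn.
  rewrite csum_sum_n. apply C_NormedModule_mixin_compat1. apply HN. lia.
Qed.

Lemma is_series_eps a s : is_series (K := C_AbsRing) (V := C_NormedModule) a s ->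
  forall eps, 0 < eps -> exists N, forall n, (N <= n)%nat -> Cmod (csum a n - s)%C < eps.
Proof.
  intros H eps He. unfold is_series in H.
  assert (0 < sqrt 2) by (apply sqrt_lt_R0; lra).
  assert (0 < eps / sqrt 2) as He2 by (apply Rdiv_lt_0_compat; lra).
  apply (filterlim_locally (F := eventually) _ s) with (eps := mkposreal _ He2) in H.
  destruct H as [N HN]. exists (S N). intros n Hn.
  destruct n as [|n]; [lia|].
  specialize (HN n ltac:(lia)). rewrite csum_sum_n in HN.
  apply C_NormedModule_mixin_compat2 in HN. simpl in HN.
  replace (sqrt 2 * (eps / sqrt 2)) with eps in HN by (field; lra). exact HN.
Qed.

Lemma series_terms_bounded u s : is_series (K := C_AbsRing) (V := C_NormedModule) u s ->
  exists M, forall n, Cmod (u n) <= M.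
Proof.
  intros H. destruct (is_series_eps u s H 1 Rlt_0_1) as [N HN].
  assert (exists M, forall n, (n < N)%nat -> Cmod (u n) <= M) as [M HM].
  { clear HN. induction N as [|N [M HM]].
    - exists 0. intros; lia.
    - exists (Rmax M (Cmod (u N))). intros n Hn.
      destruct (Nat.eq_dec n N) as [->|].
      + apply Rmax_r.
      + eapply Rle_trans; [apply HM; lia|apply Rmax_l]. }
  exists (Rmax M 2). intros n. destruct (Nat.lt_ge_cases n N) as [Hn|Hn].
  - eapply Rle_trans; [apply HM; lia|apply Rmax_l].
  - eapply Rle_trans; [|apply Rmax_r].
    pose proof (HN n Hn) as H1. pose proof (HN (S n) ltac:(lia)) as H2. simpl in H2.
    replace (u n) with ((csum u n + u n - s) - (csum u n - s))%C by ring.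
    eapply Rle_trans; [apply Cmod_triangle_minus|]. lra.
Qed.

(** The series of a function of the class converges at 1 / 2, so its terms are bounded
    there; comparison with a geometric series gives |f z - z| = O(|z|^2). *)
Lemma class_A_at_0 f : class_A f -> f (RtoC 0) = RtoC 0 /\ cderiv f (RtoC 0) (RtoC 1).
Proof.
  intros [_ [a Ha]].
  destruct (Ha (RtoC (1 / 2))) as [s0 [Hs0 _]].
  { unfold unit_disc. rewrite Cmod_R, Rabs_pos_eq; lra. }
  destruct (series_terms_bounded _ _ Hs0) as [M HM].
  assert (0 <= M) by (eapply Rle_trans; [apply Cmod_ge_0|apply (HM 0%nat)]).
  assert (forall z, Cmod z < 1 / 4 -> Cmod (f z - z)%C <= 8 * M * Cmod z ^ 2) as Hq.
  { intros z Hz. destruct (Ha z) as [s [Hs Ef]]; [unfold unit_disc; lra|].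
    replace (f z - z)%C with s by (rewrite Ef; ring).
    (* M bounds the terms at 1 / 2, so the terms at z are at most M x^k *)
    set (x := 2 * Cmod z). assert (0 <= x <= 1 / 2) as Hx by (pose proof (Cmod_ge_0 z); unfold x; lra).
    assert (forall n, Cmod (csum (fun k => a (k + 2)%nat * z ^ (k + 2))%C n)
       <= M * x ^ 2 * (2 - 2 * (/ 2) ^ n)) as Hn.
    { induction n.
      - simpl. rewrite Cmod_0. lra.
      - simpl csum. eapply Rle_trans; [apply Cmod_triangle|].
        assert (Cmod (a (n + 2)%nat * z ^ (n + 2))%C <= M * x ^ 2 * (/ 2) ^ n).
        { rewrite Cmod_mult, Cmod_pow. specialize (HM n). rewrite Cmod_mult, Cmod_pow, Cmod_R in HM.
          rewrite (Rabs_pos_eq (1 / 2)) in HM by lra.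
          replace (Cmod z) with (1 / 2 * x) by (unfold x; field).
          rewrite Rpow_mult_distr, <- Rmult_assoc.
          eapply Rle_trans; [apply Rmult_le_compat_r; [apply pow_le; lra|exact HM]|].
          rewrite Rmult_assoc. apply Rmult_le_compat_l; auto.
          rewrite pow_add, Rmult_comm. apply Rmult_le_compat_l; [apply pow_le; lra|].
          apply pow_incr. lra. }
        simpl pow. simpl pow in IHn, H0.
        assert (0 <= (/2)^n) by (apply pow_le; lra). lra. }
    replace (8 * M * Cmod z ^ 2) with (2 * (M * x ^ 2)) by (unfold x; ring).
    apply Rnot_lt_le. intros Hlt.
    destruct (is_series_eps _ _ Hs (Cmod s - 2 * (M * x ^ 2))) as [N HN]; [lra|].
    specialize (HN N (le_n _)). specialize (Hn N).
    rewrite Cmod_minus_sym in HN.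
    pose proof (Cmod_triangle_inv s (csum (fun k => a (k + 2)%nat * z ^ (k + 2))%C N)).
    assert (0 <= (/2)^N) by (apply pow_le; lra).
    assert (0 <= M * x ^ 2) by (apply Rmult_le_pos; auto; apply pow2_ge_0). nra. }
  assert (f (RtoC 0) = RtoC 0) as F0.
  { specialize (Hq (RtoC 0)). rewrite Cmod_0 in Hq. specialize (Hq ltac:(lra)).
    replace (f 0 - 0)%C with (f (RtoC 0)) in Hq by ring.
    apply Cmod_eq_0. apply Rle_antisym; [|apply Cmod_ge_0]. lra. }
  split; auto.
  apply (cderiv_of_quadratic f _ (8 * M) (1 / 4)); [lra|]. intros w Hw.
  rewrite F0. replace (f w - 0 - 1 * w)%C with (f w - w)%C by ring. auto.
Qed.

Lemma csum_shift2 u n : csum (fun k => u (k + 2)%nat) n = (csum u (n + 2) - u 0%nat - u 1%nat)%C.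
Proof.
  induction n.
  - simpl. ring.
  - simpl. rewrite IHn. ring.
Qed.

(** Taylor's theorem supplies the series, and the normalization fixes its first two
    coefficients. *)
Lemma class_A_of_holo f : holo f -> f (RtoC 0) = RtoC 0 -> cderiv f (RtoC 0) (RtoC 1) -> class_A f.
Proof.
  intros Hf H0 H1. split; [apply holo_iff; auto|].
  destruct (holo_taylor f Hf) as [a [Ha Hs]].
  assert (a 0%nat = RtoC 0) as E0 by (rewrite (is_taylor_0 f a Ha); exact H0).
  assert (a 1%nat = RtoC 1) as E1.
  { apply (cderiv_unique f (RtoC 0)); auto. apply is_taylor_1; auto. }
  exists a. intros z Hz. exists (f z - z)%C. split; [|ring].
  apply is_series_of_eps. intros eps He. destruct (Hs z Hz eps He) as [N HN].
  exists N. intros n Hn. rewrite (csum_shift2 (fun k => a k * z ^ k)%C).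
  specialize (HN (n + 2)%nat ltac:(lia)). unfold taylor_rem in HN.
  rewrite Cmod_minus_sym in HN.
  replace (csum (fun k => a k * z ^ k) (n + 2) - a 0%nat * z ^ 0 - a 1%nat * z ^ 1 - (f z - z))%C
    with (csum (fun k => a k * z ^ k) (n + 2) - f z)%C by (rewrite E0, E1; simpl; ring).
  exact HN.
Qed.

(** * The complex exponential *)

Definition cexp (z : C) : C := (exp (Re z) * cos (Im z), exp (Re z) * sin (Im z)).

Lemma cexp_plus z w : cexp (z + w)%C = (cexp z * cexp w)%C.
Proof.
  destruct z as [x y], w as [u v]. unfold cexp, Re, Im, Cplus, Cmult. simpl.
  rewrite exp_plus, cos_plus, sin_plus. f_equal; ring.
Qed.

Lemma cexp_0 : cexp (RtoC 0) = RtoC 1.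
Proof.
  unfold cexp, RtoC. simpl. rewrite exp_0, cos_0, sin_0. f_equal; ring.
Qed.

Lemma Cmod_cexp z : Cmod (cexp z) = exp (Re z).
Proof. exact (Cmod_circ (exp (Re z)) (Im z) (Rlt_le _ _ (exp_pos _))). Qed.

Lemma cexp_neq_0 z : cexp z <> RtoC 0.
Proof. apply Cmod_gt_0. rewrite Cmod_cexp. apply exp_pos. Qed.

Lemma cderiv_cexp_0 : cderiv cexp (RtoC 0) (RtoC 1).
Proof.
  intros eps He.
  assert (is_derive exp 0 1) as De by (auto_derive; auto; rewrite exp_0; ring).
  assert (is_derive cos 0 0) as Dc by (auto_derive; auto; rewrite sin_0; ring).
  assert (is_derive sin 0 1) as Ds by (auto_derive; auto; rewrite cos_0; ring).
  rewrite is_derive_eps in De, Dc, Ds.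
  set (e := Rmin 1 (eps / 8)).
  assert (0 < e <= 1 /\ e <= eps / 8) as [[E1 E2] E3].
  { unfold e. pose proof (Rmin_l 1 (eps / 8)). pose proof (Rmin_r 1 (eps / 8)).
    repeat split; auto. apply Rmin_pos; lra. }
  destruct (De e E1) as [d1 [Hd1 H1]].
  destruct (Dc e E1) as [d2 [Hd2 H2]].
  destruct (Ds e E1) as [d3 [Hd3 H3]].
  exists (Rmin (Rmin (e / 2) d1) (Rmin d2 d3)).
  split; [repeat apply Rmin_pos; lra|].
  intros w. rewrite cexp_0. replace (w - 0)%C with w by ring. intros Hw.
  pose proof (Rmin_l (Rmin (e / 2) d1) (Rmin d2 d3)).
  pose proof (Rmin_r (Rmin (e / 2) d1) (Rmin d2 d3)).
  pose proof (Rmin_l (e / 2) d1). pose proof (Rmin_r (e / 2) d1).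
  pose proof (Rmin_l d2 d3). pose proof (Rmin_r d2 d3).
  pose proof (re_le_Cmod w) as Hx. pose proof (Im_le_Cmod w) as Hy.
  set (x := Re w) in *. set (y := Im w) in *. set (m := Cmod w) in *.
  specialize (H1 x). specialize (H2 y). specialize (H3 y).
  rewrite Rminus_0_r in H1, H2, H3. rewrite exp_0 in H1. rewrite cos_0 in H2. rewrite sin_0 in H3.
  specialize (H1 ltac:(lra)). specialize (H2 ltac:(lra)). specialize (H3 ltac:(lra)).
  pose proof (Rabs_pos x). pose proof (Rabs_pos y).
  assert (Rabs (exp x - 1) <= e) as Hexp.
  { replace (exp x - 1) with ((exp x - 1 - 1 * x) + x) by ring.
    eapply Rle_trans; [apply Rabs_triang|]. nra. }
  assert (0 < exp x <= 2) as Hexp2.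
  { split; [apply exp_pos|]. apply Rabs_le_between in Hexp. lra. }
  eapply Rle_trans; [apply Cmod_le_abs|].
  replace (Re (cexp w - 1 - 1 * w)%C) with
    (exp x * (cos y - 1 - 0 * y) + (exp x - 1 - 1 * x))
    by (unfold cexp, x, y, Re, Im, RtoC, Cminus, Cmult, Cplus, Copp; simpl; ring).
  replace (Im (cexp w - 1 - 1 * w)%C) with
    (exp x * (sin y - 0 - 1 * y) + (exp x - 1) * y)
    by (unfold cexp, x, y, Re, Im, RtoC, Cminus, Cmult, Cplus, Copp; simpl; ring).
  assert (Rabs (exp x * (cos y - 1 - 0 * y) + (exp x - 1 - 1 * x)) <= 2 * (e * m) + e * m).
  { eapply Rle_trans; [apply Rabs_triang|]. rewrite Rabs_mult, (Rabs_pos_eq (exp x)) by lra.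
    apply Rplus_le_compat; [|nra].
    apply Rmult_le_compat; try lra; try apply Rabs_pos. nra. }
  assert (Rabs (exp x * (sin y - 0 - 1 * y) + (exp x - 1) * y) <= 2 * (e * m) + e * m).
  { eapply Rle_trans; [apply Rabs_triang|]. rewrite !Rabs_mult, (Rabs_pos_eq (exp x)) by lra.
    apply Rplus_le_compat.
    - apply Rmult_le_compat; try lra; try apply Rabs_pos. nra.
    - apply Rmult_le_compat; try lra; apply Rabs_pos. }
  assert (0 <= m) by apply Cmod_ge_0. nra.
Qed.

(** The addition formula transports the derivative at 0 to any other point. *)
Lemma cderiv_cexp z : cderiv cexp z (cexp z).
Proof.
  replace (cexp z) with (cexp z * (1 * 1))%C by ring.
  apply (cderiv_ext_loc (fun w => cexp z * cexp (w - z))%C _ z _ 1); [lra| |].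
  - intros w _. rewrite <- cexp_plus. f_equal. ring.
  - apply (cderiv_scal _ (fun w => cexp (w - z))%C).
    apply (cderiv_comp cexp (fun w => w - z)%C).
    + replace (z - z)%C with (RtoC 0) by ring. apply cderiv_cexp_0.
    + apply cderiv_minus_const.
Qed.

(** * Lemmas on real functions *)

Lemma between_value_root (p : R -> R) a b y :
  a < b -> (forall x, a <= x <= b -> continuity_pt p x) ->
  (p a < y < p b \/ p b < y < p a) -> exists x, a <= x <= b /\ p x = y.
Proof.
  intros Hab Hc [H|H].
  - destruct (IVT_interv (fun x => p x - y) a b) as [x [Hx E]]; auto; try lra.
    + intros x Hx. apply continuity_pt_minus; [apply Hc; auto|apply continuity_pt_const].
      intros ? ?; reflexivity.
    + exists x. split; auto. lra.
  - destruct (IVT_interv (fun x => y - p x) a b) as [x [Hx E]]; auto; try lra.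
    + intros x Hx. apply (continuity_pt_minus (fun _ => y) p); [apply continuity_pt_const|apply Hc; auto].
      intros ? ?; reflexivity.
    + exists x. split; auto. lra.
Qed.

(** If [p s > p t] for some [0 <= s < t], then [p (- t) < p t < p s], so the value [p t]
    is taken again on [[- t, s]], against injectivity. The second claim is
    symmetric. *)
Lemma injective_increasing (p : R -> R) :
  (forall x, -1 < x < 1 -> continuity_pt p x) ->
  (forall x y, -1 < x < 1 -> -1 < y < 1 -> p x = p y -> x = y) ->
  (forall s, 0 < s < 1 -> p (- s) <= p s) ->
  forall s t, 0 <= s <= t -> t < 1 -> p s <= p t /\ p (- t) <= p (- s).
Proof.
  intros Hc Hinj Hs s t Hst Ht.
  destruct (Req_dec s t) as [->|Hne]; [lra|].
  assert (p (- t) < p t) as Hlt.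
  { destruct (Hs t ltac:(lra)) as [H|E]; auto.
    apply Hinj in E; lra. }
  split; apply Rnot_lt_le; intros H.
  - destruct (between_value_root p (- t) s (p t)) as [x [Hx E]]; try lra.
    + intros x Hx. apply Hc. lra.
    + apply Hinj in E; lra.
  - destruct (between_value_root p (- s) t (p (- t))) as [x [Hx E]]; try lra.
    + intros x Hx. apply Hc. lra.
    + apply Hinj in E; lra.
Qed.

(** The bound [l] is a limit at 0, where [A] itself is not defined. *)
Lemma decreasing_from_limit (A dA : R -> R) l :
  (forall t, 0 < t <= 1 -> is_derive A t (dA t)) ->
  (forall t, 0 < t <= 1 -> dA t <= 0) ->
  (forall eps, 0 < eps -> exists t, 0 < t < 1 /\ A t <= l + eps) ->
  A 1 <= l.
Proof.
  intros HA Hd Hl. apply Rnot_lt_le. intros Hlt.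
  destruct (Hl ((A 1 - l) / 2) ltac:(lra)) as [t [Ht H]].
  destruct (MVT_gen A t 1 dA) as [c [Hc E]].
  - intros x. rewrite Rmin_left, Rmax_right by lra. intros. apply HA. lra.
  - intros x. rewrite Rmin_left, Rmax_right by lra. intros.
    apply continuity_pt_filterlim, (ex_derive_continuous A). exists (dA x). apply HA. lra.
  - rewrite Rmin_left, Rmax_right in Hc by lra. specialize (Hd c ltac:(lra)). nra.
Qed.

Lemma is_derive_ln_Cmod u t v : pderiv u t v -> u t <> RtoC 0 ->
  is_derive (fun s => ln (Cmod (u s))) t (Re (v / u t)%C).
Proof.
  intros [Ha Hb] Hn. apply Cmod_gt_0 in Hn.
  unfold Cmod in *. change (fst (u t)) with (Re (u t)) in Hn. change (snd (u t)) with (Im (u t)) in Hn.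
  set (X := Re (u t) ^ 2 + Im (u t) ^ 2) in *.
  assert (0 < X) as HX.
  { apply Rnot_le_lt. intros H. rewrite sqrt_neg_0 in Hn by auto. lra. }
  assert (is_derive (fun s => Re (u s) ^ 2 + Im (u s) ^ 2) t
    (2 * Re (u t) * Re v + 2 * Im (u t) * Im v)) as H1.
  { replace (2 * Re (u t) * Re v + 2 * Im (u t) * Im v) with
     (plus (INR 2 * Re v * Re (u t) ^ Init.Nat.pred 2) (INR 2 * Im v * Im (u t) ^ Init.Nat.pred 2))
     by (unfold plus; simpl; ring).
    apply (is_derive_plus (K := R_AbsRing) (V := R_NormedModule)); apply is_derive_pow; auto. }
  assert (is_derive (fun y => ln (sqrt y)) X (/ (2 * X))) as H2.
  { auto_derive.
    - repeat split; auto.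
    - rewrite <- (sqrt_sqrt X) at 3 by lra. field. lra. }
  pose proof (is_derive_comp (K := R_AbsRing) (V := R_NormedModule) _ _ _ _ _ H2 H1) as H3.
  replace (Re (v / u t)%C) with
    (scal (K := R_AbsRing) (2 * Re (u t) * Re v + 2 * Im (u t) * Im v) (/ (2 * X))).
  - exact H3.
  - unfold scal, X, Re, Im, Cdiv, Cinv, Cmult in *; simpl. unfold mult; simpl. unfold X in HX. field.
    simpl in HX. lra.
Qed.

Lemma exp_nondecreasing x y : x <= y -> exp x <= exp y.
Proof. intros [H| ->]; [apply Rlt_le, exp_increasing; auto|apply Rle_refl]. Qed.

(** Both sides come from [1 + y <= exp y]. *)
Lemma ln_near_1 x e : 0 < e <= 1 / 2 -> Rabs (x - 1) <= e -> Rabs (ln x) <= 2 * e.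
Proof.
  intros He H. apply Rabs_le_between in H.
  assert (forall y, 1 + y <= exp y) as Hexp.
  { intros y. destruct (Req_dec y 0) as [->|Hy]; [rewrite exp_0; lra|].
    apply Rlt_le, exp_ineq1. auto. }
  apply Rabs_le_between. split.
  - rewrite <- (ln_exp (- (2 * e))). apply ln_le; [apply exp_pos|].
    apply Rle_trans with (1 - e); [|lra].
    rewrite exp_Ropp. pose proof (Hexp (2 * e)). pose proof (exp_pos (2 * e)).
    apply Rmult_le_reg_r with (exp (2 * e)); auto. rewrite Rinv_l by lra. nra.
  - rewrite <- (ln_exp (2 * e)). apply ln_le; [lra|]. pose proof (Hexp (2 * e)). lra.
Qed.

(** * Growth along rays *)

(** [H] is the integral of [psi z / z] from 0, which appears in the growth bounds, and
    [q] is the holomorphic continuation of [psi z / z]. *)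
Definition log_primitive (psi q H : C -> C) : Prop :=
  holo q /\ (forall z, unit_disc z -> psi z = (z * q z)%C) /\
  (forall z, unit_disc z -> cderiv H z (q z)) /\ H (RtoC 0) = RtoC 0.

Lemma log_primitive_exists psi : holo psi -> psi (RtoC 0) = RtoC 0 ->
  exists q H, log_primitive psi q H.
Proof.
  intros Hh H0. destruct (holo_quotient psi Hh H0) as [q [Hq Eq]].
  destruct (primitive_on_disc q (RtoC 0)) as [G HG].
  { intros z Hz. destruct (Hq z Hz) as [l Hl]. eapply cderiv_ccont; eauto. }
  { intros z Hz _. apply Hq. exact Hz. }
  exists q, (fun z => (G z + - G 0)%C). repeat split; auto.
  - intros z Hz. replace (q z) with (q z + 0)%C by ring.
    apply cderiv_plus; [auto|apply cderiv_const].
  - ring.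
Qed.

Lemma pderiv_real_scal k t : pderiv (fun s => RtoC (k * s)) t (RtoC k).
Proof. split; simpl; auto_derive; auto; ring. Qed.

Lemma pderiv_ray z t : pderiv (fun s => RtoC s * z)%C t z.
Proof. split; unfold Re, Im, Cmult, RtoC; simpl; auto_derive; auto; ring. Qed.

Lemma is_derive_radial H q k t :
  (forall z, unit_disc z -> cderiv H z (q z)) -> Rabs (k * t) < 1 ->
  is_derive (fun s => Re (H (RtoC (k * s)))) t (k * Re (q (RtoC (k * t)))).
Proof.
  intros HH Hk.
  assert (unit_disc (RtoC (k * t))) as Hd by (unfold unit_disc; rewrite Cmod_R; auto).
  destruct (pderiv_comp H _ t _ _ (HH _ Hd) (pderiv_real_scal k t)) as [D _].
  replace (k * Re (q (RtoC (k * t)))) with (Re (q (RtoC (k * t)) * RtoC k)%C); auto.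
  unfold Re, Cmult, RtoC. simpl. ring.
Qed.

(** The sign of [k] selects the radius along which [psi] is integrated, so that both
    growth bounds are instances. At [t = 0] the integrand [Re psi / t] may differ from its
    continuous extension, which does not change the integral. *)
Lemma RInt_radial psi q H k r :
  log_primitive psi q H -> Rabs k <= 1 -> 0 < r < 1 ->
  RInt (fun t => Re (psi (RtoC (k * t))) / t) 0 r = Re (H (RtoC (k * r))).
Proof.
  intros (Hq & Eq & HH & H0) Hk Hr.
  assert (forall t, 0 <= t <= r -> Rabs (k * t) < 1) as Hin.
  { intros t Ht. rewrite Rabs_mult, (Rabs_pos_eq t) by lra. pose proof (Rabs_pos k). nra. }
  rewrite (RInt_ext _ (fun t => k * Re (q (RtoC (k * t))))).
  2: { rewrite Rmin_left, Rmax_right by lra. intros t Ht.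
       rewrite Eq by (unfold unit_disc; rewrite Cmod_R; apply Hin; lra).
       match goal with |- ?a = ?b => change (@eq R a b) end.
       transitivity (k * t * Re (q (RtoC (k * t))) / t); [f_equal; unfold Re, Cmult, RtoC; simpl; ring|].
       field. lra. }
  replace (Re (H (RtoC (k * r)))) with
    (minus (Re (H (RtoC (k * r)))) (Re (H (RtoC (k * 0))))).
  - apply is_RInt_unique.
    apply (is_RInt_derive (V := R_CompleteNormedModule) (fun t => Re (H (RtoC (k * t))))).
    + rewrite Rmin_left, Rmax_right by lra. intros t Ht.
      apply is_derive_radial; auto.
    + rewrite Rmin_left, Rmax_right by lra. intros t Ht.
      apply (continuous_mult (K := R_AbsRing) (fun _ => k) (fun t => Re (q (RtoC (k * t))))).
      * apply continuous_const.
      * apply (pcont_continuous_Re (fun t => q (RtoC (k * t)))).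
        apply (pcont_comp q (fun t => RtoC (k * t))).
        -- destruct (Hq (RtoC (k * t))) as [m Hm].
           { unfold unit_disc; rewrite Cmod_R; auto. }
           eapply cderiv_ccont; eauto.
        -- eapply pderiv_pcont. apply pderiv_real_scal.
  - rewrite Rmult_0_r, H0. unfold minus, plus, opp, Re. simpl. ring.
Qed.

Lemma Cmod_ray t z : 0 <= t -> Cmod (RtoC t * z)%C = t * Cmod z.
Proof. intros Ht. rewrite Cmod_mult, Cmod_R, Rabs_pos_eq; auto. Qed.

(** The quantity that is monotone along a ray: the logarithm of |f (t z) / t| minus the
    real part of the primitive along the real radius. With [k = |z|] it is compared with
    the upper bound, and with [k = - |z|] with the lower one. *)
Definition radial_gap (f H : C -> C) (z : C) (k t : R) : R :=
  ln (Cmod (f (RtoC t * z)%C)) - ln t - Re (H (RtoC (k * t))).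

(** The derivative of [ln |f (t z)|] in [t] is the real part of [z f' / f] at [t z],
    divided by [t], and the subordination writes it as [(1 + Re psi (om (t z))) / t]; the
    other two terms contribute [- 1 / t] and [- Re psi (k t) / t]. *)
Lemma radial_gap_derive f psi q H om z k t :
  class_A f -> (forall w, unit_disc w -> w <> RtoC 0 -> f w <> RtoC 0) ->
  (forall w, unit_disc w -> zf'_over_f f w - 1 = psi (om w))%C ->
  log_primitive psi q H ->
  0 < Cmod z < 1 -> Rabs k < 1 -> 0 < t <= 1 ->
  is_derive (radial_gap f H z k) t
    ((Re (psi (om (RtoC t * z)%C)) - Re (psi (RtoC (k * t)))) / t).
Proof.
  intros HA Hn Hsub (_ & Eq & HH & _) Hz Hk Ht.
  set (w := (RtoC t * z)%C).
  assert (Cmod w = t * Cmod z) as Ew by (apply Cmod_ray; lra).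
  assert (unit_disc w) as Hw by (unfold unit_disc; nra).
  assert (w <> RtoC 0) as Nw by (apply Cmod_gt_0; nra).
  destruct (proj1 (holo_iff f) (proj1 HA) w Hw) as [l Hl].
  assert (C_derive f w = l) as El.
  { apply is_C_derive_unique. apply cderiv_iff. exact Hl. }
  pose proof (Hn w Hw Nw) as Nf.
  assert (Rabs (k * t) < 1) as Hkt.
  { rewrite Rabs_mult, (Rabs_pos_eq t) by lra. pose proof (Rabs_pos k). nra. }
  pose proof (is_derive_ln_Cmod (fun s => f (RtoC s * z)%C) t _
    (pderiv_comp f (fun s => RtoC s * z)%C t l z Hl (pderiv_ray z t)) Nf) as D1.
  assert (is_derive ln t (/ t)) as D2 by (apply is_derive_Reals, derivable_pt_lim_ln; lra).
  pose proof (is_derive_radial H q k t HH Hkt) as D3.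
  pose proof (is_derive_minus (K := R_AbsRing) (V := R_NormedModule) _ _ _ _ _
    (is_derive_minus (K := R_AbsRing) (V := R_NormedModule) _ _ _ _ _ D1 D2) D3) as D.
  unfold radial_gap.
  replace ((Re (psi (om w)) - Re (psi (RtoC (k * t)))) / t)
    with (Re (l * z / f w)%C - / t - k * Re (q (RtoC (k * t)))); [exact D|].
  rewrite <- (Hsub w Hw).
  rewrite Eq by (unfold unit_disc; rewrite Cmod_R; auto).
  unfold zf'_over_f. destruct (Ceq_dec w 0) as [E|_]; [contradiction|]. rewrite El.
  replace (w * l / f w)%C with (RtoC t * (l * z / f w))%C by (unfold w; field; exact Nf).
  generalize (l * z / f w)%C as g. intros g.
  unfold Re, Cminus, Cplus, Copp, Cmult, RtoC; simpl. field. lra.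
Qed.

(** Near 0, [f w / w] tends to 1 and [H] tends to 0. *)
Lemma radial_gap_limit f H z k : class_A f -> ccont H (RtoC 0) -> H (RtoC 0) = RtoC 0 ->
  0 < Cmod z < 1 -> Rabs k < 1 ->
  forall eps, 0 < eps -> exists t, 0 < t < 1 /\
    Rabs (radial_gap f H z k t - ln (Cmod z)) <= eps.
Proof.
  intros HA Hc H0 Hz Hk eps He.
  destruct (class_A_at_0 f HA) as [F0 F1].
  set (e := Rmin (1 / 2) (eps / 3)).
  assert (0 < e <= 1 / 2 /\ e <= eps / 3) as [E1 E2].
  { unfold e. pose proof (Rmin_l (1 / 2) (eps / 3)). pose proof (Rmin_r (1 / 2) (eps / 3)).
    repeat split; auto. apply Rmin_pos; lra. }
  destruct (F1 e ltac:(lra)) as [d1 [Hd1 H1]].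
  destruct (Hc e ltac:(lra)) as [d2 [Hd2 H2]].
  set (t := Rmin (1 / 2) (Rmin (d1 / 2) (d2 / 2))).
  assert (0 < t <= 1 / 2 /\ t <= d1 / 2 /\ t <= d2 / 2) as (T1 & T2 & T3).
  { assert (t <= 1 / 2) by apply Rmin_l.
    assert (t <= Rmin (d1 / 2) (d2 / 2)) by apply Rmin_r.
    pose proof (Rmin_l (d1 / 2) (d2 / 2)). pose proof (Rmin_r (d1 / 2) (d2 / 2)).
    repeat split; try lra. unfold t. repeat apply Rmin_pos; lra. }
  exists t. split; [lra|].
  set (w := (RtoC t * z)%C).
  assert (Cmod w = t * Cmod z) as Ew by (apply Cmod_ray; lra).
  specialize (H1 w). replace (w - 0)%C with w in H1 by ring.
  specialize (H1 ltac:(nra)). rewrite F0 in H1.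
  replace (f w - 0 - 1 * w)%C with (f w - w)%C in H1 by ring.
  specialize (H2 (RtoC (k * t))). rewrite H0 in H2.
  replace (RtoC (k * t) - 0)%C with (RtoC (k * t)) in H2 by ring.
  replace (H (RtoC (k * t)) - 0)%C with (H (RtoC (k * t))) in H2 by ring.
  rewrite Cmod_R, Rabs_mult, (Rabs_pos_eq t) in H2 by lra.
  specialize (H2 ltac:(pose proof (Rabs_pos k); nra)).
  pose proof (re_le_Cmod (H (RtoC (k * t)))) as H3.
  assert (0 < Cmod w) as Hwp by nra.
  assert (Rabs (Cmod (f w) / Cmod w - 1) <= e) as H4.
  { replace (Cmod (f w) / Cmod w - 1) with ((Cmod (f w) - Cmod w) / Cmod w) by (field; lra).
    unfold Rdiv. rewrite Rabs_mult, Rabs_inv, (Rabs_pos_eq (Cmod w)) by lra.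
    apply Rmult_le_reg_r with (Cmod w); auto. rewrite Rmult_assoc, Rinv_l, Rmult_1_r by lra.
    eapply Rle_trans; [|exact H1]. apply Rabs_le_between. split.
    - pose proof (Cmod_triangle_inv w (f w)) as HT.
      pose proof (Cmod_triangle_inv w (w - f w)) as HT2.
      replace (w - (w - f w))%C with (f w) in HT2 by ring.
      rewrite (Cmod_minus_sym w (f w)) in HT2. lra.
    - pose proof (Cmod_triangle_inv (f w) (f w - w)) as HT.
      replace (f w - (f w - w))%C with w in HT by ring. lra. }
  assert (0 < Cmod (f w)) as Hfw.
  { apply Rabs_le_between in H4.
    assert (0 < Cmod (f w) / Cmod w) by lra.
    replace (Cmod (f w)) with (Cmod (f w) / Cmod w * Cmod w) by (field; lra).
    apply Rmult_lt_0_compat; auto. }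
  pose proof (ln_near_1 _ e E1 H4) as H5.
  unfold Rdiv in H5. rewrite ln_mult, ln_Rinv, Ew, ln_mult in H5
    by (auto; try apply Rinv_0_lt_compat; lra).
  unfold radial_gap. fold w.
  replace (ln (Cmod (f w)) - ln t - Re (H (RtoC (k * t))) - ln (Cmod z)) with
    ((ln (Cmod (f w)) + - (ln t + ln (Cmod z))) + - Re (H (RtoC (k * t)))) by ring.
  eapply Rle_trans; [apply Rabs_triang|]. rewrite Rabs_Ropp. lra.
Qed.

Lemma radial_gap_1 f H z k : radial_gap f H z k 1 = ln (Cmod (f z)) - Re (H (RtoC k)).
Proof.
  unfold radial_gap. rewrite ln_1, Rmult_1_r. replace (RtoC 1 * z)%C with z by ring. ring.
Qed.

(** * The growth theorem *)

Definition axis_extremal (psi : C -> C) : Prop :=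
  (forall r : R, 0 < r < 1 -> circle_max_Re psi r (psi (RtoC r))) /\
  (forall r : R, 0 < r < 1 -> circle_min_Re psi r (psi (RtoC (- r)))).

(** A value that equals a real maximum or minimum is real. *)
Lemma axis_extremal_real psi x : axis_extremal psi -> psi (RtoC 0) = RtoC 0 ->
  -1 < x < 1 -> psi (RtoC x) = RtoC (Re (psi (RtoC x))).
Proof.
  intros [psi_max psi_min] psi_0 Hx. destruct (Rtotal_order x 0) as [Hn|[->|Hp]].
  - destruct (psi_min (- x) ltac:(lra)) as [m [_ E]]. rewrite Ropp_involutive in E.
    rewrite <- E. reflexivity.
  - rewrite psi_0. reflexivity.
  - destruct (psi_max x ltac:(lra)) as [m [_ E]]. rewrite <- E. reflexivity.
Qed.

Lemma Re_bounds_on_circle psi w : axis_extremal psi -> 0 < Cmod w < 1 ->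
  Re (psi (RtoC (- Cmod w))) <= Re (psi w) <= Re (psi (RtoC (Cmod w))).
Proof.
  intros [psi_max psi_min] Hw. split.
  - destruct (psi_min (Cmod w) Hw) as [m [[_ Hm] E]]. rewrite <- E. apply Hm.
    exists w. auto.
  - destruct (psi_max (Cmod w) Hw) as [m [[_ Hm] E]]. rewrite <- E. apply Hm.
    exists w. auto.
Qed.

(** On the real axis [psi] is real, hence injective as a real function, and
    its minimum [psi (- s)] on a circle is at most its maximum [psi s]. *)
Lemma Re_monotone_on_axis psi s t :
  holo psi -> univalent_on_disc psi -> axis_extremal psi -> psi (RtoC 0) = RtoC 0 ->
  0 <= s <= t -> t < 1 ->
  Re (psi (RtoC s)) <= Re (psi (RtoC t)) /\ Re (psi (RtoC (- t))) <= Re (psi (RtoC (- s))).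
Proof.
  intros Hh Hinj Hext H0.
  apply (injective_increasing (fun x => Re (psi (RtoC x)))).
  - intros x Hx. apply continuity_pt_filterlim.
    apply (pcont_continuous_Re (fun x => psi (RtoC x))).
    apply (pcont_hor psi x 0).
    destruct (Hh (RtoC x)) as [l Hl].
    + unfold unit_disc. rewrite Cmod_R. apply Rabs_def1; lra.
    + eapply cderiv_ccont; eauto.
  - intros x y Hx Hy E. apply RtoC_inj. apply Hinj.
    + unfold unit_disc. rewrite Cmod_R. apply Rabs_def1; lra.
    + unfold unit_disc. rewrite Cmod_R. apply Rabs_def1; lra.
    + rewrite (axis_extremal_real psi x), (axis_extremal_real psi y) by auto. congruence.
  - intros x Hx. pose proof (Re_bounds_on_circle psi (RtoC x) Hext) as HC.
    rewrite Cmod_R, Rabs_pos_eq in HC by lra. specialize (HC Hx). lra.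
Qed.

(** The bounds on the circle of radius |w| are carried to radius [s] by monotonicity on
    the axis. *)
Lemma Re_bounds_in_disc psi w s :
  holo psi -> univalent_on_disc psi -> axis_extremal psi -> psi (RtoC 0) = RtoC 0 ->
  Cmod w <= s -> s < 1 ->
  Re (psi (RtoC (- s))) <= Re (psi w) <= Re (psi (RtoC s)).
Proof.
  intros Hh Hinj Hext H0 Hw Hs. pose proof (Cmod_ge_0 w).
  pose proof (Re_monotone_on_axis psi (Cmod w) s Hh Hinj Hext H0 ltac:(lra) Hs) as [H1 H2].
  destruct (Req_dec (Cmod w) 0) as [E|N].
  - rewrite E in *. apply Cmod_eq_0 in E. subst w. rewrite Ropp_0 in H2. lra.
  - pose proof (Re_bounds_on_circle psi w Hext ltac:(lra)). lra.
Qed.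

Lemma growth_upper_log_primitive psi q H r : log_primitive psi q H -> 0 < r < 1 ->
  growth_upper psi r = r * exp (Re (H (RtoC r))).
Proof.
  intros HP Hr. unfold growth_upper. f_equal. f_equal.
  rewrite <- (Rmult_1_l r) at 2.
  rewrite <- (RInt_radial psi q H 1 r); auto.
  - apply RInt_ext. intros t _. rewrite Rmult_1_l. reflexivity.
  - rewrite Rabs_R1. lra.
Qed.

Lemma growth_lower_log_primitive psi q H r : log_primitive psi q H -> 0 < r < 1 ->
  growth_lower psi r = r * exp (Re (H (RtoC (- r)))).
Proof.
  intros HP Hr. unfold growth_lower. f_equal. f_equal.
  replace (- r) with (-1 * r) by ring.
  rewrite <- (RInt_radial psi q H (-1) r); auto.
  - apply RInt_ext. intros t _. replace (-1 * t) with (- t) by ring. reflexivity.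
  - rewrite Rabs_left; lra.
Qed.

(** By Schwarz's lemma [om (t z)] lies in the disc of radius [t |z|], where [Re psi] is
    between its values at the two real points of the circle. So the radial gap decreases
    from its limit [ln |z|] at 0 in the upper case, and increases in the lower one. *)
Lemma growth_bounds psi q H f r z :
  holo psi -> univalent_on_disc psi -> axis_extremal psi -> psi (RtoC 0) = RtoC 0 ->
  log_primitive psi q H -> class_F psi f -> 0 < r < 1 -> Cmod z = r ->
  growth_lower psi r <= Cmod (f z) <= growth_upper psi r.
Proof.
  intros Hh Hinj Hext Hpsi0 HP [HA [Hn [_ [_ [om [Ho [Hd [Ho0 Hsub]]]]]]]] Hr Hz.
  apply holo_iff in Ho.
  rewrite (growth_upper_log_primitive psi q H), (growth_lower_log_primitive psi q H) by auto.
  pose proof HP as (Hq & Eq & HH & H_0).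
  assert (unit_disc z) as Hzd by (unfold unit_disc; lra).
  assert (0 < Cmod (f z)) as Hfz.
  { apply Cmod_gt_0. apply Hn; auto. apply Cmod_gt_0. lra. }
  assert (ccont H (RtoC 0)) as Hc.
  { eapply cderiv_ccont. apply HH. unfold unit_disc. rewrite Cmod_0. lra. }
  assert (forall t, 0 < t <= 1 ->
    Re (psi (RtoC (- (r * t)))) <= Re (psi (om (RtoC t * z)%C)) <= Re (psi (RtoC (r * t)))) as Hb.
  { intros t Ht. assert (Cmod (RtoC t * z)%C = r * t) as Et by (rewrite Cmod_ray; nra).
    apply Re_bounds_in_disc; auto; [|nra]. rewrite <- Et.
    apply schwarz_lemma; auto. unfold unit_disc. rewrite Et. nra. }
  assert (0 < Cmod z < 1) as Hz' by lra.
  assert (Rabs r < 1) as Hr1 by (rewrite Rabs_pos_eq; lra).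
  assert (Rabs (- r) < 1) as Hr2 by (rewrite Rabs_Ropp; auto).
  rewrite <- (exp_ln (Cmod (f z))) by auto.
  assert (r = exp (ln r)) as El by (rewrite exp_ln; lra).
  split; rewrite El at 1; rewrite <- exp_plus; apply exp_nondecreasing.
  - assert (- radial_gap f H z (- r) 1 <= - ln r) as Hg.
    { apply (decreasing_from_limit (fun t => - radial_gap f H z (- r) t)
        (fun t => - ((Re (psi (om (RtoC t * z)%C)) - Re (psi (RtoC (- r * t)))) / t))).
      - intros t Ht. apply (is_derive_opp (K := R_AbsRing) (V := R_NormedModule)).
        apply (radial_gap_derive f psi q H om z (- r) t); auto.
      - intros t Ht. specialize (Hb t Ht). replace (- r * t) with (- (r * t)) by ring.
        apply Ropp_le_cancel. rewrite Ropp_involutive, Ropp_0.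
        apply Rdiv_le_0_compat; lra.
      - intros eps He. destruct (radial_gap_limit f H z (- r) HA Hc H_0 Hz' Hr2 eps He) as [t [Ht HL]].
        exists t. split; auto. rewrite Hz in HL. apply Rabs_le_between in HL. lra. }
    rewrite radial_gap_1 in Hg. lra.
  - assert (radial_gap f H z r 1 <= ln r) as Hg.
    { apply (decreasing_from_limit (radial_gap f H z r)
        (fun t => (Re (psi (om (RtoC t * z)%C)) - Re (psi (RtoC (r * t)))) / t)).
      - intros t Ht. apply (radial_gap_derive f psi q H om z r t); auto.
      - intros t Ht. specialize (Hb t Ht).
        apply Ropp_le_cancel. rewrite Ropp_0.
        replace (- ((Re (psi (om (RtoC t * z)%C)) - Re (psi (RtoC (r * t)))) / t))
          with ((Re (psi (RtoC (r * t))) - Re (psi (om (RtoC t * z)%C))) / t) by (field; lra).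
        apply Rdiv_le_0_compat; lra.
      - intros eps He. destruct (radial_gap_limit f H z r HA Hc H_0 Hz' Hr1 eps He) as [t [Ht HL]].
        exists t. split; auto. rewrite Hz in HL. apply Rabs_le_between in HL. lra. }
    rewrite radial_gap_1 in Hg. lra.
Qed.

(** * The extremal function *)

(** The solution of [z f' / f = 1 + psi], that is, the member of the class whose
    subordinating function is the identity. *)
Definition extremal (H : C -> C) (z : C) : C := (z * cexp (H z))%C.

Lemma extremal_cderiv psi q H z : log_primitive psi q H -> unit_disc z ->
  cderiv (extremal H) z (cexp (H z) * (1 + psi z))%C.
Proof.
  intros (_ & Eq & HH & _) Hz.
  replace (cexp (H z) * (1 + psi z))%C with (1 * cexp (H z) + z * (cexp (H z) * q z))%C
    by (rewrite Eq by auto; ring).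
  apply (cderiv_mult (fun w => w) (fun w => cexp (H w))); [apply cderiv_id|].
  apply (cderiv_comp cexp H); [apply cderiv_cexp|auto].
Qed.

Lemma zf'_over_f_extremal psi q H z : log_primitive psi q H -> unit_disc z ->
  (zf'_over_f (extremal H) z - 1)%C = psi z.
Proof.
  intros HP Hz. unfold zf'_over_f. destruct (Ceq_dec z 0) as [->|N].
  - pose proof HP as (_ & Eq & _). rewrite Eq by auto. ring.
  - rewrite (is_C_derive_unique (extremal H) z (cexp (H z) * (1 + psi z))%C)
      by (apply cderiv_iff, (extremal_cderiv psi q); auto).
    unfold extremal. field. split; auto. apply cexp_neq_0.
Qed.

Lemma extremal_class_F psi q H : holo psi -> log_primitive psi q H ->
  class_F psi (extremal H).
Proof.
  intros Hh HP. split; [|split].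
  - apply class_A_of_holo.
    + intros z Hz. eexists. apply (extremal_cderiv psi q); auto.
    + unfold extremal. ring.
    + assert (unit_disc 0) as Hd by (unfold unit_disc; rewrite Cmod_0; lra).
      pose proof HP as (_ & Eq & _ & H0).
      replace (RtoC 1) with (cexp (H 0) * (1 + psi 0))%C
        by (rewrite H0, (Eq _ Hd), cexp_0; ring).
      apply (extremal_cderiv psi q); auto.
  - intros z Hz N. unfold extremal. apply Cmult_neq_0; auto. apply cexp_neq_0.
  - split; [|split].
    + apply holo_iff. intros z Hz. destruct (Hh z Hz) as [l Hl]. exists l.
      apply (cderiv_ext_loc psi _ z l (1 - Cmod z)); auto.
      * unfold unit_disc in Hz. lra.
      * intros w Hw. symmetry. apply (zf'_over_f_extremal psi q); auto. unfold unit_disc.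
        replace w with ((w - z) + z)%C by ring.
        eapply Rle_lt_trans; [apply Cmod_triangle|]. lra.
    + apply holo_iff. exact Hh.
    + exists (fun z => z). repeat split; auto.
      * apply holo_iff. intros z _. exists (RtoC 1). apply cderiv_id.
      * intros z Hz. apply (zf'_over_f_extremal psi q); auto.
Qed.

Lemma Cmod_extremal H z : Cmod (extremal H z) = Cmod z * exp (Re (H z)).
Proof. unfold extremal. rewrite Cmod_mult, Cmod_cexp. reflexivity. Qed.

Theorem theorem2p1 (psi : C -> C)
  (psi_analytic : analytic_on_disc psi)
  (psi_univalent : univalent_on_disc psi)
  (psi_0 : psi (RtoC 0) = RtoC 0)
  (psi_starlike : starlike_wrt_0 (disc_image psi))
  (psi_max : forall r : R, 0 < r < 1 -> circle_max_Re psi r (psi (RtoC r)))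
  (psi_min : forall r : R, 0 < r < 1 -> circle_min_Re psi r (psi (RtoC (- r)))) :
  (forall f : C -> C, class_F psi f ->
     forall (r : R) (z : C), 0 < r < 1 -> Cmod z = r ->
       growth_lower psi r <= Cmod (f z) <= growth_upper psi r) /\
  (forall r : R, 0 < r < 1 ->
     (exists (f : C -> C) (z : C),
        class_F psi f /\ Cmod z = r /\ Cmod (f z) = growth_lower psi r) /\
     (exists (f : C -> C) (z : C),
        class_F psi f /\ Cmod z = r /\ Cmod (f z) = growth_upper psi r)).
Proof.
  apply holo_iff in psi_analytic.
  destruct (log_primitive_exists psi psi_analytic psi_0) as (q & H & HP).
  assert (axis_extremal psi) as Hext by (split; assumption).
  split.
  - intros f Hf r z Hr Hz. apply (growth_bounds psi q H); auto.
  - intros r Hr. pose proof (extremal_class_F psi q H psi_analytic HP) as HF.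
    split; exists (extremal H).
    + exists (RtoC (- r)). split; [exact HF|].
      rewrite Cmod_extremal, Cmod_R, Rabs_Ropp, Rabs_pos_eq by lra.
      split; auto. symmetry. apply (growth_lower_log_primitive psi q H); auto.
    + exists (RtoC r). split; [exact HF|].
      rewrite Cmod_extremal, Cmod_R, Rabs_pos_eq by lra.
      split; auto. symmetry. apply (growth_upper_log_primitive psi q H); auto.
Qed.
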